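(* Let $\mathcal F:\mathcal P_2(\mathbb R^d)\to(-\infty,\infty]$ be proper, lower semicontinuous and geodesically convex, with minimizer $\pi$. Let $(\mu_t)_{t\ge0}$ be the forward Euler iterates with adaptive step sizes $\eta_t=\bar r_t/\sqrt{G_t}$, $t\ge0$, where $\bar r_t=\max\{r_\varepsilon,\max_{0\le s\le t}W_2(\mu_0,\mu_s)\}$, $G_t=\sum_{s=0}^t\int_{\mathbb R^d}\|\xi_s(x)\|^2\,\mathrm d\mu_s(x)$, $\xi_s=\nabla_{W_2}\mathcal F(\mu_s)$, and $r_\varepsilon>0$. Let $d_0=W_2(\mu_0,\pi)$ and let $(\tilde\mu_t)_{t\ge1}$ be the weighted averages $\tilde\mu_1=\mu_0$ and $$\tilde\mu_{t+1}=\Big[\Big(1-\tfrac{\bar r_t}{\sum_{s=0}^t\bar r_s}\Big)\mathrm{id}+\tfrac{\bar r_t}{\sum_{s=0}^t\bar r_s}\,\boldsymbol t_{\tilde\mu_t}^{\mu_t}\Big]_\#\tilde\mu_t,\qquad t\ge1.$$ Then there is a universal constant $C>0$ such that for all $1\le t\le T$, $$\mathcal F(\tilde\mu_t)-\mathcal F(\pi)\le C\,\frac{(d_0+\bar r_t)\sqrt{G_{t-1}}}{\sum_{s=0}^{t-1}\bar r_s/\bar r_t}.$$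
   Context: $\mathcal P_2(\mathbb R^d)$: Borel probability measures on $\mathbb R^d$ with finite second moment; $W_2$: quadratic Wasserstein distance; $T_\#\mu$: pushforward; $\boldsymbol t_\mu^\nu$: optimal transport map from $\mu$ to $\nu$ (whenever written, it is assumed to exist; the paper restricts the domain $\{\mathcal F<\infty\}$ to absolutely continuous measures for this purpose). Proper: $\mathcal F(\mu)<\infty$ for some $\mu$. Geodesically convex: for all $\mu,\nu$ there is a constant speed $W_2$-geodesic $(\lambda_s)_{s\in[0,1]}$ from $\mu$ to $\nu$ with $\mathcal F(\lambda_s)\le(1-s)\mathcal F(\mu)+s\mathcal F(\nu)$ for all $s\in[0,1]$. Wasserstein gradient: $\xi\in L^2(\mu)$ belongs to the Fréchet subdifferential $\partial\mathcal F(\mu)$ if $\mathcal F(\nu)-\mathcal F(\mu)\ge\int\langle\xi(x),\boldsymbol t_\mu^\nu(x)-x\rangle\,\mathrm d\mu(x)+o(W_2(\mu,\nu))$ for all $\nu$ with $\mathcal F(\nu)<\infty$; for geodesically convex $\mathcal F$ this is equivalent to the same inequality without the $o(\cdot)$ term. $\nabla_{W_2}\mathcal F(\mu)$ is the element of $\partial\mathcal F(\mu)$ of minimal $L^2(\mu)$ norm (assumed to exist along the iterates). In the paper, $\mathcal F(\mu)=\int V\,\mathrm d\mu+\frac12\iint W(x-y)\,\mathrm d\mu(x)\mathrm d\mu(y)+\int H(\mu(x))\,\mathrm dx$ is a sum of potential, interaction and internal energies. Forward Euler iterates: given $\mu_0\in\mathcal P_2(\mathbb R^d)$ and step sizes $\eta_t>0$,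 $\mu_{t+1}=(\mathrm{id}-\eta_t\xi_t)_\#\mu_t$ with $\xi_t=\nabla_{W_2}\mathcal F(\mu_t)$, $t\ge0$. Denominators in the step size formula are understood to be positive. *)

(* Defs.v *)
(* MathComp-Analysis; R^d is 'rV[R]_d over an arbitrary R : realType. *)
From HB Require Import structures.
From mathcomp Require Import all_boot all_order all_algebra.
From mathcomp Require Import all_classical all_reals all_analysis.

Set Implicit Arguments.
Unset Strict Implicit.
Unset Printing Implicit Defensive.

Import Order.TTheory GRing.Theory Num.Theory.
Import numFieldNormedType.Exports.

Local Open Scope classical_set_scope.
Local Open Scope ring_scope.

(* Borel sigma-algebra of R^d; the library topology on 'rV[R]_d is the product
   (hence the Euclidean) topology. *)
HB.instance Definition _ (R : realType) (d : nat) :=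
  Measurable.copy 'rV[R]_d (g_sigma_algebraType (@open 'rV[R]_d)).

(* The library norm `|x| on 'rV[R]_d is the sup norm, so the Euclidean
   structure is introduced separately. *)
Definition dotp (R : realType) (d : nat) (u v : 'rV[R]_d) : R :=
  \sum_(i < d) u ord0 i * v ord0 i.

Definition sqnorm (R : realType) (d : nat) (u : 'rV[R]_d) : R := dotp u u.

(* Library measures are functions on all sets, and their values on
   non-measurable sets carry no meaning: equality of measures means
   equality on measurable sets. *)
Definition eq_measurable_sets (disp : measure_display) (X : measurableType disp)
    (R : realType) (m1 m2 : set X -> \bar R) : Prop :=
  forall A : set X, measurable A -> m1 A = m2 A.

Notation "m1 =m m2" := (eq_measurable_sets m1 m2) (at level 70, no associativity).

Record P2 (R : realType) (d : nat) := MkP2 {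
  P2_prob :> probability 'rV[R]_d R ;
  P2_moment : (\int[P2_prob]_x (sqnorm x)%:E < +oo)%E }.

Definition coupling (R : realType) (d : nat) (mu nu : P2 R d)
    (gamma : probability ('rV[R]_d * 'rV[R]_d)%type R) : Prop :=
  pushforward gamma fst =m mu /\ pushforward gamma snd =m nu.

Definition W2 (R : realType) (d : nat) (mu nu : P2 R d) : R :=
  Num.sqrt (fine (ereal_inf
    [set (\int[gamma]_p (sqnorm (p.1 - p.2))%:E)%E
       | gamma in [set gamma | coupling mu nu gamma]])).

Definition optimal_map (R : realType) (d : nat) (mu nu : P2 R d)
    (T : 'rV[R]_d -> 'rV[R]_d) : Prop :=
  [/\ measurable_fun setT T,
      pushforward mu T =m nu &
      (\int[mu]_x (sqnorm (T x - x))%:E = (W2 mu nu ^+ 2)%:E)%E].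

Definition box (R : realType) (d : nat) (a b : 'rV[R]_d) : set 'rV[R]_d :=
  [set x | forall i, a ord0 i <= x ord0 i <= b ord0 i].

Definition box_volume (R : realType) (d : nat) (a b : 'rV[R]_d) : R :=
  \prod_(i < d) (b ord0 i - a ord0 i).

(* Lebesgue outer measure; it is the Lebesgue measure on Borel sets. *)
Definition lebesgue_outer (R : realType) (d : nat) (A : set 'rV[R]_d) : \bar R :=
  ereal_inf [set (\sum_(0 <= k <oo) (box_volume (ab.1 k) (ab.2 k))%:E)%E
    | ab in [set ab : (nat -> 'rV[R]_d) * (nat -> 'rV[R]_d) |
        (forall k i, ab.1 k ord0 i <= ab.2 k ord0 i) /\
        A `<=` \bigcup_k box (ab.1 k) (ab.2 k)]].

Definition absolutely_continuous (R : realType) (d : nat) (mu : P2 R d) : Prop :=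
  forall A : set 'rV[R]_d, measurable A ->
    lebesgue_outer A = 0%E -> mu A = 0%E.

(* Lower semicontinuity for the W2 distance. Since W2 mu nu = 0 when
   mu =m nu, such an F takes equal values on measures that agree on
   measurable sets. *)
Definition W2_lower_semicontinuous (R : realType) (d : nat)
    (F : P2 R d -> \bar R) : Prop :=
  forall (mu : P2 R d) (a : R), (a%:E < F mu)%E ->
    exists2 delta : R, 0 < delta &
      forall nu : P2 R d, W2 mu nu < delta -> (a%:E < F nu)%E.

Definition proper_functional (R : realType) (d : nat) (F : P2 R d -> \bar R) : Prop :=
  exists mu : P2 R d, (F mu < +oo)%E.

Definition constant_speed_geodesic (R : realType) (d : nat) (mu nu : P2 R d)
    (lam : R -> P2 R d) : Prop :=
  [/\ lam 0 =m mu, lam 1 =m nu &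
      forall s t : R, 0 <= s <= 1 -> 0 <= t <= 1 ->
        W2 (lam s) (lam t) = `|s - t| * W2 mu nu].

Definition geodesically_convex (R : realType) (d : nat)
    (F : P2 R d -> \bar R) : Prop :=
  forall mu nu : P2 R d, exists2 lam : R -> P2 R d,
    constant_speed_geodesic mu nu lam &
    forall s : R, 0 <= s <= 1 ->
      (F (lam s) <= (1 - s)%:E * F mu + s%:E * F nu)%E.

Definition in_L2 (R : realType) (d : nat) (mu : P2 R d)
    (xi : 'rV[R]_d -> 'rV[R]_d) : Prop :=
  measurable_fun setT xi /\ (\int[mu]_x (sqnorm (xi x))%:E < +oo)%E.

(* T ranges over the optimal maps from mu to nu; for absolutely continuous mu
   there is exactly one, up to mu-negligible sets. *)
Definition frechet_subdifferential (R : realType) (d : nat)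
    (F : P2 R d -> \bar R) (mu : P2 R d) (xi : 'rV[R]_d -> 'rV[R]_d) : Prop :=
  [/\ (F mu < +oo)%E,
      in_L2 mu xi &
      forall eps : R, 0 < eps -> exists2 delta : R, 0 < delta &
        forall nu : P2 R d, (F nu < +oo)%E -> W2 mu nu < delta ->
        forall T : 'rV[R]_d -> 'rV[R]_d, optimal_map mu nu T ->
          (\int[mu]_x (dotp (xi x) (T x - x))%:E - (eps * W2 mu nu)%:E
             <= F nu - F mu)%E].

Definition wasserstein_gradient (R : realType) (d : nat)
    (F : P2 R d -> \bar R) (mu : P2 R d) (xi : 'rV[R]_d -> 'rV[R]_d) : Prop :=
  frechet_subdifferential F mu xi /\
  forall zeta : 'rV[R]_d -> 'rV[R]_d, frechet_subdifferential F mu zeta ->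
    (\int[mu]_x (sqnorm (xi x))%:E <= \int[mu]_x (sqnorm (zeta x))%:E)%E.

Definition rbar (R : realType) (d : nat) (r_eps : R) (mu : nat -> P2 R d)
    (t : nat) : R :=
  Num.max r_eps (\big[Num.max/0]_(0 <= s < t.+1) W2 (mu 0%N) (mu s)).

Definition gradient_sum (R : realType) (d : nat) (mu : nat -> P2 R d)
    (xi : nat -> 'rV[R]_d -> 'rV[R]_d) (t : nat) : R :=
  \sum_(0 <= s < t.+1) \int[mu s]_x sqnorm (xi s x).

(* Main.v *)
Require Import Defs.
From HB Require Import structures.
From mathcomp Require Import all_boot all_order all_algebra.
From mathcomp Require Import all_classical all_reals all_analysis.
From mathcomp Require Import measurable_realfun.
From mathcomp Require Import ring lra.
Import Order.TTheory GRing.Theory Num.Theory.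
Import numFieldNormedType.Exports.
Local Open Scope classical_set_scope.
Local Open Scope ring_scope.
Set Implicit Arguments.
Unset Strict Implicit.
Unset Printing Implicit Defensive.

(* The squared distance [W2 (mu t) pi ^+ 2] decreases along the iteration up to
   the usual subgradient error, and the step sizes make the weighted sum of the
   gaps [F (mu s) - F pi] telescope. Jensen's inequality along the averages then
   gives the bound, with constant 3.

   Two facts of optimal transport are needed. First, composing the optimal maps
   from [mu] to a geodesic point and from there to [nu] gives an optimal map
   from [mu] to [nu] that is interpolated by the geodesic; this yields the
   global subgradient inequality, and the triangle inequality without gluing.
   Secondly, the averages are built from prescribed optimal maps whereas
   convexity holds along some geodesic, so optimal maps from an absolutely
   continuous measure must be unique. Two optimal maps [T1], [T2] are jointly
   monotone, by exchanging targets; on a set where [T1 - T2] is almost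
   constant and nonzero this forces the points to lie in a Lipschitz graph,
   which is Lebesgue null. *)

(** * Borel measurability of vector-valued maps *)

Section Measurability.
Variables (R : realType) (d : nat).
Local Notation V := 'rV[R]_d.

Lemma measurable_coord (i : 'I_d) : measurable_fun setT (fun x : V => x ord0 i).
Proof.
apply: (measurability _ (RGenOpens.measurableE R)).
move=> _ [_ [a [b ->] <-]]; rewrite setTI.
apply: sub_sigma_algebra.
by have /continuousP := @coord_continuous R 1 d ord0 i; apply; exact: interval_open.
Qed.

(** Sup norm balls with rational centre and inverse integer radius: a countable base of the
    topology. *)
Definition rational_box (q : 'rV[rat]_d * nat) : set V :=
  [set x | forall i, `|x ord0 i - ratr (q.1 ord0 i)| < q.2.+1%:R^-1].

Lemma rational_approx (x : V) (e : R) : 0 < e ->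
  exists q : 'rV[rat]_d, forall i, `|x ord0 i - ratr (q ord0 i)| < e.
Proof.
move=> e0.
have /choice[q qP] : forall i : 'I_d, exists r : rat, `|x ord0 i - ratr r| < e.
  move=> i; have /rat_in_itvoo[r] : x ord0 i - e < x ord0 i + e by lra.
  rewrite in_itv /= => /andP[r1 r2]; exists r.
  by rewrite ltr_norml; apply/andP; split; lra.
by exists (\row_i q i) => i; rewrite mxE.
Qed.

Lemma nbhs_rational_box (x : V) (e : R) : 0 < e ->
  exists2 q, rational_box q x & rational_box q `<=` ball x e.
Proof.
move=> e0; have e20 : 0 < e / 2 by lra.
have [n _ nP] := near_infty_natSinv_lt (PosNum e20).
have [|q qP] := @rational_approx x (n.+1%:R^-1); first by rewrite invr_gt0.
exists (q, n) => // y yq; split => // k i; rewrite ord1.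
have := qP i; have := yq i; have := nP n (leqnn _).
rewrite /ball /= => n1 h1 h2.
rewrite (_ : _ - _ = (x ord0 i - ratr (q ord0 i)) - (y ord0 i - ratr (q ord0 i))); last ring.
apply: (le_lt_trans (ler_normB _ _)); rewrite [e]splitr.
by apply: ltrD; [exact: lt_trans h2 n1|exact: lt_trans h1 n1].
Qed.

Lemma open_bigcup_rational_box (U : set V) : open U ->
  U = \bigcup_(q in [set q | rational_box q `<=` U]) rational_box q.
Proof.
move=> oU; apply/seteqP; split => x; last by move=> [q /= qU xq]; exact: qU.
move=> Ux; have := open_nbhs_nbhs (conj oU Ux).
move=> /nbhs_ballP [e /= e0 eU].
have [q xq qe] := nbhs_rational_box x e0.
by exists q => //=; exact: subset_trans qe eU.
Qed.

Lemma measurable_preimage_rational_box disp (X : measurableType disp) (f : X -> V) q :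
  (forall i, measurable_fun setT (fun x => f x ord0 i)) ->
  measurable (f @^-1` rational_box q).
Proof.
move=> mf; rewrite (_ : f @^-1` rational_box q = \bigcap_(i in [set: 'I_d])
  ((fun x => f x ord0 i) @^-1` ball (ratr (q.1 ord0 i) : R) q.2.+1%:R^-1)); last first.
  apply/seteqP; split => x /= xq i => [_|]; last first.
    by have := xq i Logic.I; rewrite /ball /= distrC.
  by rewrite /ball /= distrC; exact: xq.
apply: fin_bigcap_measurable => // i _; rewrite -[X in measurable X]setTI.
by apply: mf => //; exact: measurable_ball.
Qed.

Lemma measurable_rational_box q : measurable (rational_box q).
Proof. exact: (measurable_preimage_rational_box (f := id) q measurable_coord). Qed.

(** Open sets are countable unions of rational boxes, and the preimage of a box is a finite
    intersection of coordinate preimages. *)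
Lemma measurable_rV disp (X : measurableType disp) (f : X -> V) :
  (forall i, measurable_fun setT (fun x => f x ord0 i)) -> measurable_fun setT f.
Proof.
move=> mf; apply: (measurability (@open 'rV[R]_d)) => //.
move=> _ [U oU <-]; rewrite setTI (open_bigcup_rational_box oU).
rewrite preimage_bigcup bigcup_mkcond.
apply: countable_bigcupT_measurable => [|q]; first exact: countableP.
by case: ifP => // _; exact: measurable_preimage_rational_box.
Qed.

Section Operations.
Context disp (X : measurableType disp).
Implicit Types f g : X -> V.

Lemma measurable_rV_coord f i :
  measurable_fun setT f -> measurable_fun setT (fun x => f x ord0 i).
Proof. by move=> mf; exact: (measurableT_comp (measurable_coord i)). Qed.

Lemma measurable_rVD f g : measurable_fun setT f -> measurable_fun setT g ->
  measurable_fun setT (fun x => f x + g x).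
Proof.
move=> mf mg; apply: measurable_rV => i.
under eq_fun do rewrite mxE.
by apply: measurable_funD; exact: measurable_rV_coord.
Qed.

Lemma measurable_rVZ (c : R) f : measurable_fun setT f ->
  measurable_fun setT (fun x => c *: f x).
Proof.
move=> mf; apply: measurable_rV => i.
under eq_fun do rewrite mxE.
by apply: measurable_funM => //; exact: measurable_rV_coord.
Qed.

Lemma measurable_rVB f g : measurable_fun setT f -> measurable_fun setT g ->
  measurable_fun setT (fun x => f x - g x).
Proof.
move=> mf mg; under eq_fun do rewrite -scaleN1r.
by apply: measurable_rVD => //; exact: measurable_rVZ.
Qed.

Lemma measurable_dotp f g : measurable_fun setT f -> measurable_fun setT g ->
  measurable_fun setT (fun x => dotp (f x) (g x)).
Proof.
move=> mf mg; apply: measurable_sum => i.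
by apply: measurable_funM; exact: measurable_rV_coord.
Qed.

Lemma measurable_sqnorm f : measurable_fun setT f ->
  measurable_fun setT (fun x => sqnorm (f x)).
Proof. by move=> mf; exact: measurable_dotp. Qed.

End Operations.
End Measurability.

(** * Algebra of the Euclidean inner product *)

Section Euclid.
Variables (R : realType) (d : nat).
Implicit Types u v w : 'rV[R]_d.

Lemma dotpC u v : dotp u v = dotp v u.
Proof. by apply: eq_bigr => i _; rewrite mulrC. Qed.

Lemma dotpDl u v w : dotp (u + v) w = dotp u w + dotp v w.
Proof. by rewrite -big_split; apply: eq_bigr => i _; rewrite mxE mulrDl. Qed.

Lemma dotpZl c u v : dotp (c *: u) v = c * dotp u v.
Proof. by rewrite /dotp mulr_sumr; apply: eq_bigr => i _; rewrite mxE mulrA. Qed.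

Lemma dotpNl u v : dotp (- u) v = - dotp u v.
Proof. by rewrite -scaleN1r dotpZl mulN1r. Qed.

Lemma dotpDr u v w : dotp u (v + w) = dotp u v + dotp u w.
Proof. by rewrite dotpC dotpDl !(dotpC u). Qed.

Lemma dotpZr c u v : dotp u (c *: v) = c * dotp u v.
Proof. by rewrite dotpC dotpZl dotpC. Qed.

Lemma dotpNr u v : dotp u (- v) = - dotp u v.
Proof. by rewrite dotpC dotpNl dotpC. Qed.

Definition dotpE := (dotpDl, dotpDr, dotpNl, dotpNr, dotpZl, dotpZr).

Lemma sqnorm_ge0 u : 0 <= sqnorm u.
Proof. by apply: sumr_ge0 => i _; rewrite -expr2 sqr_ge0. Qed.

Lemma sqnorm_eq0 u : sqnorm u = 0 -> u = 0.
Proof.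
move=> /eqP; rewrite psumr_eq0 => [/allP u0|i _]; last by rewrite -expr2 sqr_ge0.
apply/rowP => i; rewrite mxE; apply/eqP.
by have := u0 i (mem_index_enum _); rewrite mulf_eq0 orbb.
Qed.

(** Convexity of the square with its exact defect, which vanishes precisely when [u] and [v] are in
    proportion [s] to [1 - s]. Optimality of composed maps is read off from this defect. *)
Lemma sqnorm_add_weighted (s : R) u v : 0 < s < 1 ->
  sqnorm (u + v) + (s * (1 - s))^-1 * sqnorm ((1 - s) *: u - s *: v) =
  s^-1 * sqnorm u + (1 - s)^-1 * sqnorm v.
Proof.
move=> /andP[s0 s1]; rewrite /sqnorm !dotpE (dotpC v u); field.
by apply/andP; split; lra.
Qed.

Lemma norm_dotp_le u v : `|dotp u v| <= (sqnorm u + sqnorm v) / 2.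
Proof.
have := sqnorm_ge0 (u + v); have := sqnorm_ge0 (u - v).
rewrite /sqnorm !dotpE (dotpC v u) => h1 h2.
by rewrite ler_norml; apply/andP; split; lra.
Qed.

End Euclid.

(** * Equal mixtures of two probability measures *)

Section Mixture.
Context disp (X : measurableType disp) (R : realType).
Variables P Q : probability X R.

Definition mixture : set X -> \bar R :=
  mscale (2^-1)%:nng (measure_add P Q).

HB.instance Definition _ := Measure.on mixture.

Lemma mixtureE A : mixture A = ((2^-1)%:E * (P A + Q A))%E.
Proof. by congr (_ * _)%E; exact: measure_addE. Qed.

Let mixture_setT : mixture setT = 1%E.
Proof.
rewrite mixtureE !probability_setT -EFinD -EFinM.
by congr (_%:E); lra.
Qed.

HB.instance Definition _ :=
  Measure_isProbability.Build _ _ _ mixture mixture_setT.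

End Mixture.

(** * Couplings and upper bounds on the Wasserstein distance *)

Section Coupling.
Variables (R : realType) (d : nat).
Local Notation V := 'rV[R]_d.
Implicit Types mu nu rho : P2 R d.

Lemma measurable_EFin_sqnorm disp (X : measurableType disp) (f : X -> V) :
  measurable_fun setT f -> measurable_fun setT (fun x => (sqnorm (f x))%:E).
Proof. by move=> mf; apply/measurable_EFinP; exact: measurable_sqnorm. Qed.

Lemma EFin_sqnorm_ge0 (u : V) : (0 <= (sqnorm u)%:E)%E.
Proof. by rewrite lee_fin sqnorm_ge0. Qed.

Lemma W2_ge0 mu nu : 0 <= W2 mu nu.
Proof. exact: sqrtr_ge0. Qed.

Lemma W2_sqr_le_coupling mu nu (gamma : probability (V * V)%type R) :
  coupling mu nu gamma ->
  ((W2 mu nu ^+ 2)%:E <= \int[gamma]_p (sqnorm (p.1 - p.2))%:E)%E.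
Proof.
move=> cg; rewrite /W2; set I := ereal_inf _.
have I0 : (0 <= I)%E.
  by apply: le_ereal_inf_tmp => _ [g _ <-]; apply: integral_ge0 => p _; exact: EFin_sqnorm_ge0.
have Ig : (I <= \int[gamma]_p (sqnorm (p.1 - p.2))%:E)%E.
  by apply: ereal_inf_lbound; exists gamma.
rewrite sqr_sqrtr ?fine_ge0//.
(* Only an infinite infimum needs an argument: [fine] turns it into 0, and the cost of [gamma] is
   then infinite. *)
move: I0 Ig; case: I => //= _; rewrite leye_eq => /eqP ->.
exact: leey.
Qed.

Section Laws.
Context disp (X : measurableType disp) (P : probability X R).

(** The mixture of the laws of [(X1, Y1)] and [(X2, Y2)] is a coupling as soon as the marginals are
    right on average. This is what survives when targets are exchanged between two pairs. *)
Lemma W2_le_mixture mu nu (X1 Y1 X2 Y2 : X -> V) :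
  measurable_fun setT X1 -> measurable_fun setT Y1 ->
  measurable_fun setT X2 -> measurable_fun setT Y2 ->
  (forall A, measurable A ->
     (P (X1 @^-1` A) + P (X2 @^-1` A) = mu A + mu A)%E) ->
  (forall A, measurable A ->
     (P (Y1 @^-1` A) + P (Y2 @^-1` A) = nu A + nu A)%E) ->
  ((2 * W2 mu nu ^+ 2)%:E <=
   \int[P]_x (sqnorm (X1 x - Y1 x))%:E + \int[P]_x (sqnorm (X2 x - Y2 x))%:E)%E.
Proof.
move=> mX1 mY1 mX2 mY2 Pmu Pnu.
have m1 := measurable_fun_pair mX1 mY1; have m2 := measurable_fun_pair mX2 mY2.
pose mf1 := isMeasurableFun.Build _ _ _ _ _ m1.
pose Z1 : {mfun X >-> (V * V)%type} := HB.pack (fun x => (X1 x, Y1 x)) mf1.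
pose mf2 := isMeasurableFun.Build _ _ _ _ _ m2.
pose Z2 : {mfun X >-> (V * V)%type} := HB.pack (fun x => (X2 x, Y2 x)) mf2.
pose gamma := mixture (distribution P Z1) (distribution P Z2).
have half (x y z : \bar R) : (x + y = z + z)%E -> ((2^-1)%:E * (x + y) = z)%E.
  move=> ->; case: z => [z| |]; rewrite ?addye//.
  - by rewrite -EFinD -EFinM; congr (_%:E); lra.
  - by rewrite gt0_muley// lte_fin invr_gt0.
  - by rewrite gt0_muleNy// lte_fin invr_gt0.
have cg : coupling mu nu gamma.
  split=> A mA; apply: etrans (mixtureE _ _ _) _.
    by apply: half; exact: Pmu.
  by apply: half; exact: Pnu.
have msq : measurable_fun setT (fun p : V * V => (sqnorm (p.1 - p.2))%:E).
  by apply/measurable_EFin_sqnorm/measurable_rVB.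
have := W2_sqr_le_coupling cg.
rewrite /gamma /mixture ge0_integral_mscale//; last first.
  by move=> *; exact: EFin_sqnorm_ge0.
rewrite ge0_integral_measure_add//; last by move=> *; exact: EFin_sqnorm_ge0.
rewrite !ge0_integral_distribution//; try by move=> *; exact: EFin_sqnorm_ge0.
by move=> h; rewrite EFinM -lee_pdivlMl.
Qed.

Lemma W2_sqr_le mu nu (X1 Y1 : X -> V) :
  measurable_fun setT X1 -> measurable_fun setT Y1 ->
  pushforward P X1 =m mu -> pushforward P Y1 =m nu ->
  ((W2 mu nu ^+ 2)%:E <= \int[P]_x (sqnorm (X1 x - Y1 x))%:E)%E.
Proof.
move=> mX mY Pmu Pnu.
have := @W2_le_mixture mu nu X1 Y1 X1 Y1 mX mY mX mY.
have -> : ((2 * W2 mu nu ^+ 2)%:E = 2%:E * (W2 mu nu ^+ 2)%:E)%E by rewrite EFinM.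
set I := (\int[P]_x _)%E => h.
have : (2%:E * (W2 mu nu ^+ 2)%:E <= 2%:E * I)%E.
  rewrite [leRHS](_ : _ = I + I)%E; last by rewrite mule_natl mule2n.
  by apply: h => A mA; [rewrite -(Pmu A mA)|rewrite -(Pnu A mA)].
by rewrite lee_pmul2l.
Qed.
End Laws.

Lemma eq_W2 mu mu' nu nu' : mu =m mu' -> nu =m nu' -> W2 mu nu = W2 mu' nu'.
Proof.
move=> emu enu; rewrite /W2; do 3 congr (_ _).
apply/seteqP; split => _ [g [gmu gnu] <-]; exists g => //; split => A mA.
- by rewrite gmu// emu.
- by rewrite gnu// enu.
- by rewrite gmu// emu.
- by rewrite gnu// enu.
Qed.

Lemma W2_refl mu : W2 mu mu = 0.
Proof.
have := @W2_sqr_le _ _ mu mu mu id id (@measurable_id _ _ _) (@measurable_id _ _ _)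
  (fun _ _ => erefl) (fun _ _ => erefl).
rewrite (eq_integral (cst 0%E)) => [|x _]; last first.
  by rewrite subrr /sqnorm /dotp big1// => i _; rewrite mxE mulr0.
rewrite integral0 lee_fin => h.
by apply/eqP; rewrite -sqrf_eq0 eq_le h sqr_ge0.
Qed.

End Coupling.

(** * Composition of optimal maps and the triangle inequality *)

Section Composition.
Variables (R : realType) (d : nat).
Local Notation V := 'rV[R]_d.
Implicit Types mu nu lam : P2 R d.

Lemma ge0_integral_law disp (X : measurableType disp)
    (P : {measure set X -> \bar R}) (m : {measure set V -> \bar R})
    (T : X -> V) (f : V -> \bar R) :
  measurable_fun setT T -> pushforward P T =m m ->
  measurable_fun setT f -> (forall x, 0 <= f x)%E ->
  (\int[P]_x f (T x) = \int[m]_x f x)%E.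
Proof.
move=> mT Tm mf f0.
transitivity (\int[pushforward P T]_x f x)%E.
  by rewrite [RHS]ge0_integral_pushforward.
by apply: eq_measure_integral => A mA _; exact: Tm.
Qed.

Lemma pushforward_comp mu lam nu (T S : V -> V) :
  measurable_fun setT S -> pushforward mu T =m lam -> pushforward lam S =m nu ->
  pushforward mu (S \o T) =m nu.
Proof.
move=> mS Tlam Snu A mA; rewrite -Snu// /pushforward -Tlam//.
by rewrite -[X in measurable X]setTI; exact: mS.
Qed.

(** Under [mu] the pair [(T x, x)] couples [nu] with [mu] at the same cost. With maps in both
    directions this gives symmetry. *)
Lemma W2_le_flip mu nu (T : V -> V) : optimal_map mu nu T -> W2 nu mu <= W2 mu nu.
Proof.
move=> [mT Tnu Topt].
have := @W2_sqr_le _ _ _ _ mu nu mu T id mT (@measurable_id _ _ _) Tnu (fun _ _ => erefl).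
by rewrite Topt lee_fin ler_pXn2r ?nnegrE ?W2_ge0.
Qed.

(** Integrates [sqnorm_add_weighted] for the two successive displacements [T x - x] and
    [S (T x) - T x]. *)
Lemma integral_composition_cost mu lam nu (T S : V -> V) (s : R) :
  0 < s < 1 -> optimal_map mu lam T -> optimal_map lam nu S ->
  (\int[mu]_x (sqnorm (S (T x) - x))%:E +
   (s * (1 - s))^-1%:E * \int[mu]_x
     (sqnorm ((1 - s) *: (T x - x) - s *: (S (T x) - T x)))%:E =
   (s^-1 * W2 mu lam ^+ 2 + (1 - s)^-1 * W2 lam nu ^+ 2)%:E)%E.
Proof.
move=> s01 [mT Tlam Topt] [mS Snu Sopt]; have /andP[s0 s1] := s01.
have mST : measurable_fun setT (S \o T) by exact: measurableT_comp.
have mSx : measurable_fun setT (fun x => S x - x) by exact: measurable_rVB.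
have mTx : measurable_fun setT (fun x => T x - x) by exact: measurable_rVB.
have mSTT : measurable_fun setT (fun x => S (T x) - T x) by exact: measurable_rVB.
have mSTx : measurable_fun setT (fun x => S (T x) - x) by exact: measurable_rVB.
have ge0 := @EFin_sqnorm_ge0 R d.
have STopt : (\int[mu]_x (sqnorm (S (T x) - T x))%:E = (W2 lam nu ^+ 2)%:E)%E.
  rewrite -Sopt; apply: (ge0_integral_law (f := fun y => (sqnorm (S y - y))%:E)) => //.
  exact: measurable_EFin_sqnorm.
rewrite -ge0_integralZl//; last 2 first.
- apply: measurable_EFin_sqnorm; apply: measurable_rVB; exact: measurable_rVZ.
- by rewrite lee_fin invr_ge0 mulr_ge0//; lra.
rewrite -ge0_integralD//; last 3 first.
- exact: measurable_EFin_sqnorm.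
- by move=> x _; rewrite -EFinM lee_fin mulr_ge0 ?sqnorm_ge0// invr_ge0 mulr_ge0//; lra.
- apply: measurable_funeM; apply: measurable_EFin_sqnorm; apply: measurable_rVB; exact: measurable_rVZ.
under eq_integral => x _.
  rewrite -EFinM -EFinD.
  rewrite (_ : S (T x) - x = (T x - x) + (S (T x) - T x)); last first.
    by rewrite [RHS]addrC addrA subrK.
  rewrite sqnorm_add_weighted// EFinD !EFinM.
  over.
rewrite ge0_integralD//; last 4 first.
- by move=> x _; rewrite -EFinM lee_fin mulr_ge0 ?sqnorm_ge0// invr_ge0 ltW.
- by apply: measurable_funeM; exact: measurable_EFin_sqnorm.
- by move=> x _; rewrite -EFinM lee_fin mulr_ge0 ?sqnorm_ge0// invr_ge0 subr_ge0 ltW.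
- by apply: measurable_funeM; exact: measurable_EFin_sqnorm.
rewrite !ge0_integralZl//; last 4 first.
- exact: measurable_EFin_sqnorm.
- by rewrite lee_fin invr_ge0 subr_ge0 ltW.
- exact: measurable_EFin_sqnorm.
- by rewrite lee_fin invr_ge0 ltW.
by rewrite Topt STopt EFinD !EFinM.
Qed.

Lemma W2_sqr_le_map mu nu (T : V -> V) :
  measurable_fun setT T -> pushforward mu T =m nu ->
  ((W2 mu nu ^+ 2)%:E <= \int[mu]_x (sqnorm (T x - x))%:E)%E.
Proof.
move=> mT Tnu.
under eq_integral do rewrite -opprB /sqnorm dotpNl dotpNr opprK.
apply: (W2_sqr_le (@measurable_id _ _ _) mT _ Tnu).
by move=> A mA.
Qed.

Lemma W2_sqr_le_composition mu lam nu (T S : V -> V) (s : R) :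
  0 < s < 1 -> optimal_map mu lam T -> optimal_map lam nu S ->
  W2 mu nu ^+ 2 <= s^-1 * W2 mu lam ^+ 2 + (1 - s)^-1 * W2 lam nu ^+ 2.
Proof.
move=> s01 oT oS; rewrite -lee_fin -(integral_composition_cost s01 oT oS).
have [mT Tlam _] := oT; have [mS Snu _] := oS.
have mST : measurable_fun setT (S \o T) by exact: measurableT_comp.
have /andP[s0 s1] := s01.
apply: (le_trans (W2_sqr_le_map mST (pushforward_comp mS Tlam Snu))).
rewrite leeDl// mule_ge0//; first by rewrite lee_fin invr_ge0 mulr_ge0//; lra.
by apply: integral_ge0 => x _; exact: EFin_sqnorm_ge0.
Qed.

(** The minimum over [s] of [s^-1 * a ^+ 2 + (1 - s)^-1 * b ^+ 2] is [(a + b) ^+ 2]. *)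
Lemma W2_triangle mu lam nu (T S : V -> V) :
  optimal_map mu lam T -> optimal_map lam nu S ->
  W2 mu nu <= W2 mu lam + W2 lam nu.
Proof.
move=> oT oS; set a := W2 mu lam; set b := W2 lam nu.
have a0 : 0 <= a := W2_ge0 _ _; have b0 : 0 <= b := W2_ge0 _ _.
apply/ler_addgt0Pr => e e0; pose f := e / 2; have f0 : 0 < f by rewrite /f; lra.
(* The weight [s = a / (a + b)] would be optimal; [f] keeps it inside ]0, 1[. *)
pose D := a + b + f + f; have D0 : 0 < D by rewrite /D; lra.
pose s := (a + f) / D.
have s0 : 0 < s by rewrite divr_gt0//; lra.
have s1 : 1 - s = (b + f) / D by rewrite /s /D; field; rewrite -/D; lra.
have s10 : 0 < 1 - s by rewrite s1 divr_gt0//; lra.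
have s01 : 0 < s < 1 by rewrite s0 -subr_gt0.
have := W2_sqr_le_composition s01 oT oS; rewrite -/a -/b => h.
have -> : a + b + e = D by rewrite /D /f; lra.
rewrite -(@ler_pXn2r _ 2) ?nnegrE ?W2_ge0//; last exact: ltW.
apply: (le_trans h); rewrite s1 /s !invf_div.
have bnd x : 0 <= x -> D / (x + f) * x ^+ 2 <= D * (x + f).
  move=> x0; rewrite -mulrA ler_pM2l// mulrC ler_pdivrMr; nra.
apply: (le_trans (lerD (bnd _ a0) (bnd _ b0))).
by rewrite /D; nra.
Qed.

(** The distances of a geodesic make the right side of [integral_composition_cost] equal to
    [W2 mu nu ^+ 2]. The cost of [S \o T] is at least that, so it is optimal and the defect vanishes
    almost everywhere. *)
Lemma optimal_map_comp mu lam nu (T S : V -> V) (s : R) :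
  0 < s < 1 -> optimal_map mu lam T -> optimal_map lam nu S ->
  W2 mu lam = s * W2 mu nu -> W2 lam nu = (1 - s) * W2 mu nu ->
  optimal_map mu nu (S \o T) /\
  {ae mu, forall x, T x - x = s *: (S (T x) - x)}.
Proof.
move=> s01 oT oS e1 e2; have := integral_composition_cost s01 oT oS.
have [mT Tlam _] := oT; have [mS Snu _] := oS.
have mST : measurable_fun setT (S \o T) by exact: measurableT_comp.
have /andP[s0 s1] := s01.
have -> : s^-1 * W2 mu lam ^+ 2 + (1 - s)^-1 * W2 lam nu ^+ 2 = W2 mu nu ^+ 2.
  by rewrite e1 e2; field; apply/andP; split; lra.
have := W2_sqr_le_map mST (pushforward_comp mS Tlam Snu).
have Tnu := pushforward_comp mS Tlam Snu.
set I := (\int[mu]_x (sqnorm (S (T x) - x))%:E)%E => h1.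
set J := (\int[mu]_x _)%E => h2.
have c0 : 0 < (s * (1 - s))^-1 by rewrite invr_gt0 mulr_gt0//; lra.
have J0 : (0 <= J)%E by apply: integral_ge0 => x _; exact: EFin_sqnorm_ge0.
have I0 : (0 <= I)%E by apply: integral_ge0 => x _; exact: EFin_sqnorm_ge0.
have cJ0 : (0 <= ((s * (1 - s))^-1)%:E * J)%E by rewrite mule_ge0// lee_fin ltW.
have II : I = (W2 mu nu ^+ 2)%:E.
  by apply/eqP; rewrite eq_le h1 andbT -h2 leeDl.
have {}J0 : J = 0%E.
  apply/eqP; rewrite eq_le J0 andbT.
  have : (((s * (1 - s))^-1)%:E * J <= 0)%E.
    by move: h2; rewrite II => h2; rewrite -(@leeD2lE _ (W2 mu nu ^+ 2)%:E)// adde0 h2.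
  by rewrite pmule_rle0.
split; first by split.
have : (\int[mu]_x `|(sqnorm ((1 - s) *: (T x - x) - s *: (S (T x) - T x)))%:E| = 0)%E.
  rewrite -[RHS]J0; apply: eq_integral => x _.
  by rewrite gee0_abs// lee_fin sqnorm_ge0.
move/ae_eq_integral_abs => /= h; apply: filterS (h _ _) => //; last first.
  apply: measurable_EFin_sqnorm; apply: measurable_rVB; apply: measurable_rVZ;
    by apply: measurable_rVB.
move=> x /= /(_ Logic.I) [] /sqnorm_eq0 /eqP; rewrite subr_eq0 => /eqP e.
rewrite scalerBl scale1r in e.
rewrite -[LHS](subrK (s *: (T x - x))) e -scalerDr; congr (_ *: _).
by rewrite addrA subrK.
Qed.

End Composition.

(** * Joint monotonicity of two optimal maps *)

Section Monotonicity.
Variables (R : realType) (d : nat).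
Local Notation V := 'rV[R]_d.

(** Swapping two events on [E] only moves mass between the two terms, so exchanged targets keep
    their total law. *)
Lemma measure_exchange disp (X : measurableType disp) (P : {measure set X -> \bar R})
    (E U1 U2 : set X) : measurable E -> measurable U1 -> measurable U2 ->
  (P ((E `&` U2) `|` (~` E `&` U1)) + P ((E `&` U1) `|` (~` E `&` U2)) =
   P U1 + P U2)%E.
Proof.
move=> mE mU1 mU2.
have mC : measurable (~` E) by exact: measurableC.
have dis (A B : set X) : (E `&` A) `&` (~` E `&` B) = set0.
  by apply/seteqP; split => // x [[Ex _] [/(_ Ex)]].
have split (U : set X) : measurable U -> P U = (P (E `&` U) + P (~` E `&` U))%E.
  move=> mU; rewrite -measureU//; try exact: measurableI.
    by rewrite -setIUl setUv setTI.
rewrite !measureU//; try exact: measurableI; try exact: dis.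
by rewrite (split U1)// (split U2)// addeACA [RHS]addeACA; congr (_ + _)%E; exact: addeC.
Qed.

Section Exchange.
Variables (mu nu : P2 R d) (T1 T2 : V -> V).
Hypotheses (oT1 : optimal_map mu nu T1) (oT2 : optimal_map mu nu T2).

Let P : probability (V * V)%type R := (mu \x mu)%E.

Let law_fst : pushforward P fst =m mu.
Proof.
move=> A mA; rewrite /pushforward (_ : fst @^-1` A = A `*` setT); last first.
  by apply/seteqP; split => -[x y] //= [].
by apply: etrans (product_measure1E _ _ mA measurableT) _; rewrite [X in (_ * X)%E](probability_setT mu) mule1.
Qed.

Let law_snd : pushforward P snd =m mu.
Proof.
move=> A mA; rewrite /pushforward (_ : snd @^-1` A = setT `*` A); last first.
  by apply/seteqP; split => -[x y] //= [].
by apply: etrans (product_measure1E _ _ measurableT mA) _; rewrite [X in (X * _)%E](probability_setT mu) mul1e.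
Qed.

(* If a positive mass of pairs [(x, T1 x)], [(x', T2 x')] violated monotonicity,
   exchanging the targets of these pairs would give a cheaper coupling. *)
Lemma optimal_map_monotone :
  {ae P, forall p, 0 <= dotp (p.1 - p.2) (T1 p.1 - T2 p.2)}.
Proof.
have [mT1 T1nu cost1] := oT1; have [mT2 T2nu cost2] := oT2.
have m1 : measurable_fun setT (fun p : V * V => p.1) := measurable_fst.
have m2 : measurable_fun setT (fun p : V * V => p.2) := measurable_snd.
have mT11 : measurable_fun setT (fun p : V * V => T1 p.1) by exact: measurableT_comp.
have mT22 : measurable_fun setT (fun p : V * V => T2 p.2) by exact: measurableT_comp.
pose D (p : V * V) := dotp (p.1 - p.2) (T1 p.1 - T2 p.2).
have mD : measurable_fun setT D.
  by apply: measurable_dotp; exact: measurable_rVB.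
(* [e] marks the violating pairs; [Y1] and [Y2] are the targets after the exchange. *)
pose e p := D p < 0.
have me : measurable_fun setT e by apply: measurable_fun_ltr => //.
pose Y1 p := if e p then T2 p.2 else T1 p.1.
pose Y2 p := if e p then T1 p.1 else T2 p.2.
have mY1 : measurable_fun setT Y1 by exact: measurable_fun_ifT.
have mY2 : measurable_fun setT Y2 by exact: measurable_fun_ifT.
have lawX A : measurable A -> (P (fst @^-1` A) + P (snd @^-1` A) = mu A + mu A)%E.
  by move=> mA; congr (_ + _)%E; [exact: law_fst|exact: law_snd].
have lawY A : measurable A -> (P (Y1 @^-1` A) + P (Y2 @^-1` A) = nu A + nu A)%E.
  move=> mA; pose E := e @^-1` [set true].
  pose U1 := (fun p : V * V => T1 p.1) @^-1` A.
  pose U2 := (fun p : V * V => T2 p.2) @^-1` A.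
  have -> : Y1 @^-1` A = (E `&` U2) `|` (~` E `&` U1).
    apply/seteqP; split => p; rewrite /Y1 /E /U1 /U2 /=; case: (e p) => //.
    - by left.
    - by move=> ?; right; split.
    - by move=> [[]|[]].
    - by move=> [[]|[]].
  have -> : Y2 @^-1` A = (E `&` U1) `|` (~` E `&` U2).
    apply/seteqP; split => p; rewrite /Y2 /E /U1 /U2 /=; case: (e p) => //.
    - by left.
    - by move=> ?; right; split.
    - by move=> [[]|[]].
    - by move=> [[]|[]].
  have mpre (f : V -> V) : measurable_fun setT f -> measurable (f @^-1` A).
    by move=> mf; rewrite -[X in measurable X]setTI; exact: mf.
  rewrite measure_exchange; last 3 first.
  - by rewrite -[X in measurable X]setTI; exact: me.
  - by rewrite -[X in measurable X]setTI; exact: mT11.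
  - by rewrite -[X in measurable X]setTI; exact: mT22.
  congr (_ + _)%E.
    by rewrite -(T1nu _ mA); exact: (law_fst (mpre _ mT1)).
  by rewrite -(T2nu _ mA); exact: (law_snd (mpre _ mT2)).
have := W2_le_mixture m1 mY1 m2 mY2 lawX lawY.
set I1 := (\int[P]_x _)%E; set I2 := (\int[P]_x _)%E => le2W.
(* Exchanging targets changes the cost of a pair by [2 * D p], so the exchange saves [2 * N p], with
   [N] the negative part of [D]. As the new cost cannot be below [2 * W2 mu nu ^+ 2], the integral
   of [N] is 0. *)
pose N p := Num.max 0 (- D p).
have N0 p : 0 <= N p by rewrite le_max lexx.
have mN : measurable_fun setT N by apply: measurable_maxr => //; exact: measurableT_comp.
have total : (I1 + I2 + 2%:E * \int[P]_p (N p)%:E = (2 * W2 mu nu ^+ 2)%:E)%E.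
  have J1 : (\int[P]_p (sqnorm (T1 p.1 - p.1))%:E = (W2 mu nu ^+ 2)%:E)%E.
    rewrite -cost1; apply: (ge0_integral_law (f := fun x => (sqnorm (T1 x - x))%:E)) => //.
      by apply: measurable_EFin_sqnorm; exact: measurable_rVB.
    by move=> x; exact: EFin_sqnorm_ge0.
  have J2 : (\int[P]_p (sqnorm (T2 p.2 - p.2))%:E = (W2 mu nu ^+ 2)%:E)%E.
    rewrite -cost2; apply: (ge0_integral_law (f := fun x => (sqnorm (T2 x - x))%:E)) => //.
      by apply: measurable_EFin_sqnorm; exact: measurable_rVB.
    by move=> x; exact: EFin_sqnorm_ge0.
  have -> : (2 * W2 mu nu ^+ 2)%:E = ((W2 mu nu ^+ 2)%:E + (W2 mu nu ^+ 2)%:E)%E.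
    by rewrite -EFinD; congr (_%:E); ring.
  rewrite -{1}J1 -{1}J2.
  have s0 := @EFin_sqnorm_ge0 R d.
  have ms (f g : V * V -> V) : measurable_fun setT f -> measurable_fun setT g ->
      measurable_fun setT (fun p => (sqnorm (f p - g p))%:E).
    by move=> mf mg; apply: measurable_EFin_sqnorm; exact: measurable_rVB.
  have N0E p : (0 <= (N p)%:E)%E by rewrite lee_fin.
  have mNE : measurable_fun setT (EFin \o N) by exact/measurable_EFinP.
  rewrite -ge0_integralZl// -ge0_integralD//; try exact: ms.
  rewrite -ge0_integralD//; last 4 first.
  - by move=> p _; exact: adde_ge0.
  - by apply: emeasurable_funD; exact: ms.
  - by move=> p _; rewrite mule_ge0// lee_fin.
  - exact: measurable_funeM.
  rewrite -ge0_integralD//; try exact: ms.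
  apply: eq_integral => p _; rewrite -EFinM -!EFinD; congr (_%:E).
  rewrite /N /Y1 /Y2 /e; case: ltP => [D0|D0].
    rewrite max_r; last by rewrite oppr_ge0 ltW.
    rewrite /D /sqnorm !dotpE.
    rewrite (dotpC (T1 p.1) p.1) (dotpC (T1 p.1) p.2).
    rewrite (dotpC (T2 p.2) p.1) (dotpC (T2 p.2) p.2).
    ring.
  rewrite max_l; last by rewrite oppr_le0.
  rewrite mulr0 addr0; congr (_ + _); by rewrite -opprB /sqnorm dotpNl dotpNr opprK.
have IN0 : (\int[P]_p (N p)%:E = 0)%E.
  have IN_ge0 : (0 <= \int[P]_p (N p)%:E)%E by apply: integral_ge0 => p _; rewrite lee_fin.
  apply/eqP; rewrite eq_le IN_ge0 andbT -(@pmule_rle0 _ 2%:E)//.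
  rewrite -(@leeD2lE _ (2 * W2 mu nu ^+ 2)%:E)// adde0.
  by rewrite -[leRHS]total; apply: leeD.
have : (\int[P]_p `|(N p)%:E| = 0)%E.
  by rewrite -[RHS]IN0; apply: eq_integral => p _; rewrite gee0_abs// lee_fin.
move/ae_eq_integral_abs => /= h; apply: filterS (h _ _) => //; last exact/measurable_EFinP.
move=> p /= /(_ Logic.I) [] Np0.
have : - D p <= N p by rewrite le_max lexx orbT.
by rewrite Np0 oppr_le0.
Qed.

End Exchange.
End Monotonicity.

(** * Lebesgue null sets from finite box covers *)

Section NullSets.
Variables (R : realType) (d : nat).
Local Notation V := 'rV[R]_d.

Lemma box_volume_ge0 (a b : V) :
  (forall j, a ord0 j <= b ord0 j) -> 0 <= box_volume a b.
Proof. by move=> ab; apply: prodr_ge0 => j _; rewrite subr_ge0. Qed.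

Lemma box_volume_xx (a : V) (i : 'I_d) : box_volume a a = 0.
Proof. by rewrite /box_volume (bigD1 i)//= subrr mul0r. Qed.

(** The finite family is padded to a sequence by the box reduced to the origin. Its volume is 0
    because the axis [i] makes the dimension positive. *)
Lemma lebesgue_outer_le_finite_cover (i : 'I_d) (I : finType) (a b : I -> V)
    (S : set V) :
  (forall k j, a k ord0 j <= b k ord0 j) ->
  S `<=` \bigcup_k box (a k) (b k) ->
  (lebesgue_outer S <= (\sum_k box_volume (a k) (b k))%:E)%E.
Proof.
move=> ab Sab.
pose ext (f : I -> V) (n : nat) :=
  if insub n is Some k then f (@enum_val _ I k) else 0.
have extE f (k : 'I_#|I|) : ext f k = f (enum_val k).
  by rewrite /ext valK.
have ext0 f n : (#|I| <= n)%N -> ext f n = 0.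
  by move=> In; rewrite /ext insubF// ltnNge In.
have abn n j : ext a n ord0 j <= ext b n ord0 j.
  have [In|nI] := leqP #|I| n; first by rewrite !ext0.
  by have := ab (enum_val (Ordinal nI)) j; rewrite -!extE.
apply: ge_ereal_inf; exists (\sum_(k : I) box_volume (a k) (b k))%:E => //.
exists (ext a, ext b) => /=.
  split=> // x /Sab [k _ xk]; exists (enum_rank k : nat) => //=.
  by rewrite !extE !enum_rankK.
have vol0 n : (0 <= (box_volume (ext a n) (ext b n))%:E)%E.
  by rewrite lee_fin box_volume_ge0.
rewrite (nneseries_split 0 #|I|)// add0n eseries0 => [|n nI _]; last first.
  by rewrite !ext0// (box_volume_xx 0 i).
rewrite adde0 sumEFin big_mkord; congr (_%:E).
transitivity (\sum_(k < #|I|) box_volume (a (enum_val k)) (b (enum_val k))).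
  by apply: eq_bigr => k _; rewrite !extE.
by rewrite -(big_enum_val (A := I) (fun k => box_volume (a k) (b k))).
Qed.

Lemma grid_cell (m : nat) (h y : R) : 0 < h -> 0 <= y <= m.+1%:R * h ->
  exists k : 'I_m.+1, k%:R * h <= y <= k.+1%:R * h.
Proof.
move=> h0; elim: m => [|m IH] /andP[y0 ym].
  by exists ord0; rewrite mul0r y0 ym.
have [yle|ygt] := leP y (m.+1%:R * h).
  have [|k /andP[k1 k2]] := IH; first by rewrite y0.
  by exists (widen_ord (leqnSn _) k); rewrite /= k1.
by exists ord_max; rewrite /= ym (ltW ygt).
Qed.

(* [S] is contained in a Lipschitz graph over the hyperplane orthogonal to the
   [i]-th axis, so each column of a grid of mesh [h] meets it in a set of height
   [O(h)]. *)
Lemma lebesgue_outer_lipschitz_graph (i : 'I_d) (M K : R) (S : set V) :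
  0 < M -> 0 <= K ->
  (forall x, S x -> forall j, `|x ord0 j| <= M) ->
  (forall x y, S x -> S y -> forall h : R, 0 < h ->
     (forall j, j != i -> `|x ord0 j - y ord0 j| <= h) ->
     `|x ord0 i - y ord0 i| <= K * h) ->
  lebesgue_outer S = 0%E.
Proof.
move=> M0 K0 SM SK.
have outer_ge0 : (0 <= lebesgue_outer S)%E.
  apply: le_ereal_inf_tmp => _ [ab [/= abP _] <-].
  by apply: nneseries_ge0 => n _ _; rewrite lee_fin box_volume_ge0.
(* The columns have total base area [(2 * M) ^+ d.-1] and each box has height [2 * K * h], with mesh
   [h = 2 * M / m.+1]. *)
suff bound m : (lebesgue_outer S <= (4 * K * M * (2 * M) ^+ d.-1 / m.+1%:R)%:E)%E.
  set c := 4 * K * M * (2 * M) ^+ d.-1 in bound.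
  have c0 : 0 <= c by rewrite /c !mulr_ge0// ?exprn_ge0 ?mulr_ge0// ltW.
  apply/eqP; rewrite eq_le outer_ge0 andbT; apply/lee_addgt0Pr => e e0.
  rewrite add0e.
  have [m _ /(_ m (leqnn _))/= mP] := near_infty_natSinv_lt (PosNum (divr_gt0 e0 (ltr_wpDl c0 ltr01))).
  apply: (le_trans (bound m)); rewrite lee_fin.
  have : c / m.+1%:R <= (c + 1) / m.+1%:R by rewrite ler_pM2r ?invr_gt0 ?ltr0n//; lra.
  move/le_trans; apply.
  by rewrite mulrC -ler_pdivlMr; [exact: ltW|lra].
pose h := 2 * M / m.+1%:R; have h0 : 0 < h by rewrite divr_gt0 ?mulr_gt0.
have hm : m.+1%:R * h = 2 * M by rewrite /h mulrC divfK// pnatr_eq0.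
pose cell (f : {ffun 'I_d -> 'I_m.+1}) : set V := [set x | S x /\
  forall j, j != i -> (f j)%:R * h <= x ord0 j + M <= (f j).+1%:R * h].
pose c (f : {ffun 'I_d -> 'I_m.+1}) : V := get (cell f).
(* A column is given by the indices [f j] with [j != i]; fixing [f i] at [ord0] counts it once. The
   box is centred in height at a chosen point [c f] of [S], and is degenerate when [f] is not
   good. *)
pose good (f : {ffun 'I_d -> 'I_m.+1}) := (f i == ord0) && `[< cell f !=set0 >].
pose a (f : {ffun 'I_d -> 'I_m.+1}) : V := if good f then
  \row_j (if j == i then c f ord0 i - K * h else (f j)%:R * h - M) else 0.
pose b (f : {ffun 'I_d -> 'I_m.+1}) : V := if good f then
  \row_j (if j == i then c f ord0 i + K * h else (f j).+1%:R * h - M) else 0.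
have Kh0 : 0 <= K * h by rewrite mulr_ge0// ltW.
have ab f j : a f ord0 j <= b f ord0 j.
  rewrite /a /b; case: (good f) => //; rewrite !mxE; case: (j == i); first lra.
  by rewrite lerD2r ler_pM2r// ler_nat.
have Sab : S `<=` \bigcup_f box (a f) (b f).
  move=> x Sx.
  have /choice[g gP] : forall j : 'I_d, exists k : 'I_m.+1,
      k%:R * h <= x ord0 j + M <= k.+1%:R * h.
    move=> j; apply: grid_cell => //; rewrite hm.
    by have := SM x Sx j; rewrite ler_norml => /andP[? ?]; apply/andP; split; lra.
  pose f : {ffun 'I_d -> 'I_m.+1} := [ffun j => if j == i then ord0 else g j].
  have cx : cell f x.
    by split=> // j /negbTE ji; rewrite /f ffunE ji; exact: gP.
  have cne : cell f !=set0 by exists x.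
  have goodf : good f by rewrite /good ffunE eqxx eqxx; apply/asboolP.
  have [Sc cc] : cell f (c f) := getPex cne.
  exists f => // j; rewrite /a /b goodf !mxE; case: eqVneq => [->|ji].
    have /(SK x (c f) Sx Sc h h0) : forall k, k != i -> `|x ord0 k - c f ord0 k| <= h.
      move=> k ki; have /andP[x1 x2] := cx.2 k ki; have /andP[c1 c2] := cc k ki.
      rewrite -natr1 mulrDl mul1r in x2 c2.
      by rewrite ler_norml; apply/andP; split; lra.
    by rewrite ler_norml => /andP[l1 l2]; apply/andP; split; lra.
  have /andP[] := cx.2 j ji; move=> h1 h2; apply/andP; split; lra.
apply: (le_trans (lebesgue_outer_le_finite_cover i ab Sab)); rewrite lee_fin.
(* Side lengths as a function of axis and index, so that the sum over [f] of products becomes a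
   product of sums. The value 0 off [ord0] on axis [i] encodes [f i = ord0]. *)
pose g (j : 'I_d) (k : 'I_m.+1) : R :=
  if j == i then (if k == ord0 then 2 * (K * h) else 0) else h.
have g0 j k : 0 <= g j k.
  by rewrite /g; case: ifP => _; [case: ifP => _ //; lra|exact: ltW].
apply: (@le_trans _ _ (\sum_(f : {ffun 'I_d -> 'I_m.+1}) \prod_j g j (f j))).
  apply: ler_sum => f _; rewrite /a /b; case: ifPn => [/andP[/eqP fi _]|_]; last first.
    by rewrite (box_volume_xx 0 i); apply: prodr_ge0.
  rewrite /box_volume; apply: ler_prod => j _; rewrite !mxE /g.
  case: eqVneq => [->|ji]; first by rewrite fi eqxx; apply/andP; split; lra.
  rewrite -natr1; apply/andP; split; lra.
rewrite -(bigA_distr_bigA g) (bigD1 i)//=.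
have -> : \sum_k g i k = 2 * (K * h).
  rewrite /g eqxx (bigD1 ord0)//= big1 ?addr0// => k /negbTE ->//.
under eq_bigr => j ji.
  under eq_bigr => k _ do rewrite /g (negbTE ji).
  rewrite sumr_const card_ord -mulr_natl hm.
  over.
rewrite prodr_const cardC1 card_ord.
rewrite le_eqVlt; apply/orP; left; apply/eqP.
by rewrite /h; field; rewrite addrC natr1 pnatr_eq0.
Qed.

End NullSets.

(** * Countable unions of negligible sets and selection of points *)

Section Negligible.
Context disp (X : measurableType disp) (R : realType).
Variable P : {measure set X -> \bar R}.

Lemma negligible_bigcup_countType (I : countType) (F : I -> set X) :
  (forall i, P.-negligible (F i)) -> P.-negligible (\bigcup_i F i).
Proof.
move=> F0; pose G n := if unpickle n is Some i then F i else set0.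
apply: (@negligibleS _ _ _ _ (\bigcup_n G n)).
  by move=> x [i _ Fix]; exists (pickle i) => //; rewrite /G pickleK.
apply: negligible_bigcup => n; rewrite /G; case: unpickle => // .
exact: negligible_set0.
Qed.

Lemma ae_exists_in (B : set X) (Q : X -> Prop) : measurable B ->
  P B != 0%E -> {ae P, forall x, Q x} -> exists2 x, B x & Q x.
Proof.
move=> mB PB [N [mN PN QN]]; apply: contrapT => noQ.
case/eqP: PB; apply: (@subset_measure0 _ _ _ _ _ _ mB mN _ PN) => x Bx.
by apply: QN => /= Qx; apply: noQ; exists x.
Qed.

End Negligible.

(** * Uniqueness of optimal maps from absolutely continuous measures *)

Section Uniqueness.
Variables (R : realType) (d : nat).
Local Notation V := 'rV[R]_d.
Implicit Types mu nu : P2 R d.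

Lemma measurable_ball_rV (x : V) (e : R) : measurable (ball x e).
Proof.
have [e0|e0] := ltP 0 e; first by apply: sub_sigma_algebra; exact: ball_open.
rewrite (_ : ball x e = set0); first exact: measurable0.
by apply/seteqP; split => // y [e1 _]; move: e0; rewrite leNgt e1.
Qed.

Lemma ball_coord (x y : V) (e : R) j : ball x e y -> `|x ord0 j - y ord0 j| < e.
Proof. by move=> [_ /(_ ord0 j)]. Qed.

(* [B] is the trace on [A] of the support of the restriction of [mu] to [A]. *)
Lemma measure_support mu (A : set V) : measurable A -> exists B : set V,
  [/\ measurable B, B `<=` A, mu.-negligible (A `\` B) &
      forall x, B x -> forall e : R, 0 < e -> exists2 U : set V,
        measurable U & U `<=` ball x e /\ mu (A `&` U) != 0%E].
Proof.
move=> mA.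
pose F q : set V := if mu (A `&` rational_box q) == 0%E then rational_box q else set0.
have mF q : measurable (F q).
  by rewrite /F; case: ifP => _; [exact: measurable_rational_box|exact: measurable0].
have mUF : measurable (\bigcup_q F q).
  by apply: countable_bigcupT_measurable => //; exact: countableP.
exists (A `\` \bigcup_q F q); split.
- exact: measurableD.
- by move=> x [].
- apply: (@negligibleS _ _ _ _ (\bigcup_q (A `&` F q))).
    move=> x [Ax nB]; apply: contrapT => nAF; apply: nB; split => // -[q _ Fq].
    by apply: nAF; exists q.
  apply: negligible_bigcup_countType => q.
  rewrite /F; case: ifPn => [/eqP mu0|_]; last by rewrite setI0; exact: negligible_set0.
  by apply/negligibleP => //; apply: measurableI => //; exact: measurable_rational_box.
- move=> x [Ax nF] e e0; have [q xq qe] := nbhs_rational_box x e0.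
  exists (rational_box q); first exact: measurable_rational_box.
  split => //; apply/negP => mu0; apply: nF; exists q => //.
  by rewrite /F mu0.
Qed.

(** [w + e] and [f - w] are nearly opposite, so [z] can have nonnegative product with both only if
    it is nearly orthogonal to [w]. The errors are at most half of the coordinate [i] of [w], hence
    that coordinate of [z] is controlled by the others. *)
Lemma cone_bound (z w e f : V) (i : 'I_d) :
  (forall j, `|e ord0 j| <= `|w ord0 i| / 2) ->
  (forall j, `|f ord0 j| <= `|w ord0 i| / 2) ->
  0 <= dotp z (w + e) -> 0 <= dotp z (f - w) ->
  `|w ord0 i| * `|z ord0 i| <=
    2 * \sum_(j < d | j != i) (`|w ord0 j| + `|w ord0 i| / 2) * `|z ord0 j|.
Proof.
move=> eW fW; set W := `|w ord0 i| in eW fW *.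
set S := \sum_(j < d | j != i) _.
have W0 : 0 <= W by exact: normr_ge0.
(* Used with [u = w] and [u = - w], to bound [z ord0 i * w ord0 i] from both sides. *)
have key (u v : V) : (forall j, `|u ord0 j| <= `|w ord0 j|) ->
    (forall j, `|v ord0 j| <= W / 2) -> 0 <= dotp z (u + v) ->
    - (z ord0 i * u ord0 i) <= `|z ord0 i| * (W / 2) + S.
  move=> uw vW; rewrite /dotp (bigD1 i)//= mxE mulrDr => h.
  have hS : \sum_(j < d | j != i) z ord0 j * (u + v) ord0 j <= S.
    apply: ler_sum => j _; rewrite mxE.
    apply: (le_trans (ler_norm _)); rewrite normrM mulrC ler_wpM2r//.
    by apply: (le_trans (ler_normD _ _)); exact: lerD.
  have hv : z ord0 i * v ord0 i <= `|z ord0 i| * (W / 2).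
    by apply: (le_trans (ler_norm _)); rewrite normrM ler_wpM2l.
  lra.
move=> h1 h2.
have k1 := key w e (fun j => lexx _) eW h1.
have k2 : z ord0 i * w ord0 i <= `|z ord0 i| * (W / 2) + S.
  have := key (- w) f _ fW; rewrite addrC mxE mulrN opprK; apply => //.
  by move=> j; rewrite mxE normrN.
have : W * `|z ord0 i| <= `|z ord0 i| * (W / 2) + S.
  by rewrite -normrM mulrC ler_norml; apply/andP; split; lra.
lra.
Qed.

(** For [x], [y] in this set [T1 x - T2 y] is near [p - q] and [T2 x - T1 y] is near [q - p].
    Monotonicity and [cone_bound] then make the coordinate [i] a Lipschitz function of the others,
    up to a negligible set. *)
Lemma separated_set_negligible mu nu (T1 T2 : V -> V) (p q : V) (i : 'I_d) (M : R) :
  absolutely_continuous mu -> optimal_map mu nu T1 -> optimal_map mu nu T2 ->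
  mu.-negligible (T1 @^-1` ball p (`|p ord0 i - q ord0 i| / 4) `&`
    T2 @^-1` ball q (`|p ord0 i - q ord0 i| / 4) `&` ball (0 : V) M).
Proof.
move=> ac o1 o2; have [mT1 _ _] := o1; have [mT2 _ _] := o2.
set W := `|p ord0 i - q ord0 i|; set A := _ `&` ball 0 M.
have [W0|W0] := leP W 0.
  rewrite (_ : A = set0); first exact: negligible_set0.
  by apply/seteqP; split => // x [[[e0 _] _] _]; lra.
have [M0|M0] := leP M 0.
  rewrite (_ : A = set0); first exact: negligible_set0.
  by apply/seteqP; split => // x [_ [e0 _]]; lra.
have mA : measurable A.
  apply: measurableI; last exact: measurable_ball_rV.
  apply: measurableI; rewrite -[X in measurable X]setTI.
    by apply: mT1 => //; exact: measurable_ball_rV.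
  by apply: mT2 => //; exact: measurable_ball_rV.
(* Monotonicity holds only for almost all pairs. Points of [B] have positive mass of [A] around
   them, so any two of them are close to a monotone pair. *)
have [B [mB BA AB0 Bsupp]] := measure_support mu mA.
suff muB : mu B = 0%E.
  apply: (@negligibleS _ _ _ _ (B `|` A `\` B)).
    by move=> x Ax; have [Bx|nBx] := pselect (B x); [left|right].
  by apply: negligibleU => //; exact/negligibleP.
apply: ac => //.
pose L := \sum_(j < d | j != i) (`|p ord0 j - q ord0 j| + W / 2).
have L0 : 0 <= L by apply: sumr_ge0 => j _; rewrite addr_ge0// divr_ge0// ltW.
(* [6 * L / W] comes from [cone_bound] with the other coordinates of [z] at most [3 * h]; the 2
   accounts for moving [x] and [y] by less than [h] each. *)
have K0 : 0 <= 6 * L / W + 2 by rewrite addr_ge0// divr_ge0 ?mulr_ge0// ltW.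
apply: (lebesgue_outer_lipschitz_graph (i := i) M0 K0).
  move=> x /BA [_ /ball_coord xM] j.
  by have := xM j; rewrite mxE sub0r normrN => /ltW.
move=> x y Bx By h h0 xyh.
have [U mU [Ux muU]] := Bsupp x Bx h h0.
have [U' mU' [Uy muU']] := Bsupp y By h h0.
have mAU : measurable (A `&` U) by exact: measurableI.
have mAU' : measurable (A `&` U') by exact: measurableI.
have muAA : (mu \x mu)%E ((A `&` U) `*` (A `&` U')) != 0%E.
  by rewrite product_measure1E// mule_neq0.
have mono : {ae (mu \x mu)%E, forall s : V * V,
    0 <= dotp (s.1 - s.2) (T1 s.1 - T2 s.2) /\
    0 <= dotp (s.1 - s.2) (T2 s.1 - T1 s.2)}.
  exact: filterI (optimal_map_monotone o1 o2) (optimal_map_monotone o2 o1).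
have [[x1 y1] [[Ax1 Ux1] [Ay1 Uy1]] [/= mono12 mono21]] :=
  ae_exists_in (measurableX mAU mAU') muAA mono.
have [[T1x1 T2x1] _] := Ax1; have [[T1y1 T2y1] _] := Ay1.
pose z : V := x1 - y1.
have zxy j : `|z ord0 j - (x ord0 j - y ord0 j)| <= 2 * h.
  have := ball_coord j (Ux _ Ux1); have := ball_coord j (Uy _ Uy1).
  rewrite /z !mxE !ltr_norml => /andP[? ?] /andP[? ?].
  by rewrite ler_norml; apply/andP; split; lra.
have zj j : j != i -> `|z ord0 j| <= 3 * h.
  move=> /xyh; have := zxy j; rewrite !ler_norml => /andP[? ?] /andP[? ?].
  by apply/andP; split; lra.
have wi : (p - q) ord0 i = p ord0 i - q ord0 i by rewrite !mxE.
(* The balls have radius [W / 4], so each coordinate of the two errors stays below [W / 2]. *)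
have := @cone_bound z (p - q) ((T1 x1 - T2 y1) - (p - q)) ((T2 x1 - T1 y1) + (p - q)) i.
rewrite wi -/W (addrC (p - q)) subrK addrK => cone.
have {}cone : W * `|z ord0 i| <= 2 * (L * (3 * h)).
  apply: (le_trans (cone _ _ _ _)) => //.
  - move=> j; have := ball_coord j T1x1; have := ball_coord j T2y1.
    rewrite -/W !mxE !ltr_norml => /andP[? ?] /andP[? ?].
    by rewrite ler_norml; apply/andP; split; lra.
  - move=> j; have := ball_coord j T2x1; have := ball_coord j T1y1.
    rewrite -/W !mxE !ltr_norml => /andP[? ?] /andP[? ?].
    by rewrite ler_norml; apply/andP; split; lra.
  rewrite ler_pM2l// /L mulr_suml; apply: ler_sum => j ji.
  rewrite [(p - q) ord0 j](_ : _ = p ord0 j - q ord0 j); last by rewrite !mxE.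
  apply: ler_wpM2l; last exact: zj.
  by rewrite addr_ge0// divr_ge0// ltW.
have : `|z ord0 i| <= 6 * L / W * h.
  rewrite -(ler_pM2l W0) (_ : W * (6 * L / W * h) = 2 * (L * (3 * h)))//.
  by field; rewrite gt_eqF.
have := zxy i; rewrite !ler_norml => /andP[? ?] /andP[? ?].
by apply/andP; split; lra.
Qed.

(** Rational [p], [q], a coordinate and an integer bound give countably many sets as in
    [separated_set_negligible], which cover all points where the maps differ. *)
Lemma optimal_map_unique mu nu (T1 T2 : V -> V) :
  absolutely_continuous mu -> optimal_map mu nu T1 -> optimal_map mu nu T2 ->
  {ae mu, forall x, T1 x = T2 x}.
Proof.
move=> ac o1 o2.
pose F (k : 'rV[rat]_d * 'rV[rat]_d * 'I_d * nat) :=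
  let p : V := map_mx ratr k.1.1.1 in let q : V := map_mx ratr k.1.1.2 in
  let i := k.1.2 in
  T1 @^-1` ball p (`|p ord0 i - q ord0 i| / 4) `&`
    T2 @^-1` ball q (`|p ord0 i - q ord0 i| / 4) `&` ball (0 : V) k.2%:R.
apply: (@negligibleS _ _ _ _ (\bigcup_k F k)); last first.
  by apply: negligible_bigcup_countType => k; 
  exact: (separated_set_negligible (map_mx ratr k.1.1.1) (map_mx ratr k.1.1.2) k.1.2 k.2%:R ac o1 o2).
move=> x /= T12.
have [i Ti] : exists i, T1 x ord0 i != T2 x ord0 i.
  apply: contrapT => nT; apply: T12; apply/rowP => i.
  by apply/eqP; apply: contrapT => /negP ?; apply: nT; exists i.
pose D := `|T1 x ord0 i - T2 x ord0 i|.
have D0 : 0 < D by rewrite normr_gt0 subr_eq0.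
(* Precision [D / 8] leaves [p] and [q] at least [3 * D / 4] apart in coordinate [i], and a quarter
   of that exceeds [D / 8]. *)
have D80 : 0 < D / 8 by lra.
have [p pP] := rational_approx (T1 x) D80.
have [q qP] := rational_approx (T2 x) D80.
have pq : D / 8 <= `|ratr (p ord0 i) - ratr (q ord0 i)| / 4 :> R.
  have : D <= `|T1 x ord0 i - ratr (p ord0 i)| + `|T2 x ord0 i - ratr (q ord0 i)| + `|ratr (p ord0 i) - ratr (q ord0 i)|.
    rewrite /D (_ : T1 x ord0 i - T2 x ord0 i = (T1 x ord0 i - ratr (p ord0 i)) -
      (T2 x ord0 i - ratr (q ord0 i)) + (ratr (p ord0 i) - ratr (q ord0 i))); last ring.
    by apply: (le_trans (ler_normD _ _)); rewrite lerD2r ler_normB.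
  by have := pP i; have := qP i; lra.
have e0 : 0 < `|ratr (p ord0 i) - ratr (q ord0 i)| / 4 :> R by lra.
exists (p, q, i, Num.bound (\sum_j `|x ord0 j|)) => //.
rewrite /F /= !mxE; split; [split|]; split.
- exact: e0.
- move=> k j; rewrite ord1 /ball /= mxE distrC; exact: lt_le_trans (pP j) pq.
- exact: e0.
- move=> k j; rewrite ord1 /ball /= mxE distrC; exact: lt_le_trans (qP j) pq.
- by apply: (le_lt_trans _ (archi_boundP _)); rewrite sumr_ge0.
- move=> k j; rewrite ord1 /ball /= mxE sub0r normrN.
  apply: (le_lt_trans _ (archi_boundP _)); last by rewrite sumr_ge0.
  by rewrite (bigD1 j)//= lerDl sumr_ge0.
Qed.

End Uniqueness.

(** * Geodesic convexity expressed through optimal maps *)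

Section Convexity.
Variables (R : realType) (d : nat) (F : P2 R d -> \bar R).
Local Notation V := 'rV[R]_d.
Implicit Types mu nu rho : P2 R d.

Hypotheses (FNy : forall nu, (-oo < F nu)%E)
  (Flsc : W2_lower_semicontinuous F) (Fconv : geodesically_convex F)
  (Fac : forall nu, (F nu < +oo)%E -> absolutely_continuous nu)
  (Fmap : forall nu rho : P2 R d, (F nu < +oo)%E -> (F rho < +oo)%E ->
       exists tr : V -> V, optimal_map nu rho tr).

Lemma functional_fineK mu : (F mu < +oo)%E -> F mu = (fine (F mu))%:E.
Proof. by move=> Fmu; rewrite fineK// fin_numElt FNy Fmu. Qed.

(** Measures equal on measurable sets are at distance 0, hence within every radius that lower
    semicontinuity provides. *)
Lemma eq_functional mu nu : mu =m nu -> F mu = F nu.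
Proof.
suff le (rho sigma : P2 R d) : rho =m sigma -> (F rho <= F sigma)%E.
  by move=> e; apply/eqP; rewrite eq_le !le// => A mA; rewrite e.
move=> e; rewrite leNgt; apply/negP => Flt.
have Fs : (F sigma < +oo)%E by exact: lt_le_trans Flt (leey _).
rewrite functional_fineK// in Flt.
have [delta delta0] := Flsc Flt.
have -> : W2 rho = W2 sigma by apply/funext => tau; exact: eq_W2.
by move=> /(_ sigma); rewrite W2_refl => /(_ delta0); rewrite -functional_fineK// ltxx.
Qed.

Lemma W2_triangle_functional mu nu rho :
  (F mu < +oo)%E -> (F nu < +oo)%E -> (F rho < +oo)%E ->
  W2 mu rho <= W2 mu nu + W2 nu rho.
Proof.
move=> Fmu Fnu Frho; have [T oT] := Fmap Fmu Fnu; have [S oS] := Fmap Fnu Frho.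
exact: W2_triangle oT oS.
Qed.

Lemma W2_sym_functional mu nu :
  (F mu < +oo)%E -> (F nu < +oo)%E -> W2 mu nu = W2 nu mu.
Proof.
move=> Fmu Fnu; have [T oT] := Fmap Fmu Fnu; have [S oS] := Fmap Fnu Fmu.
by apply/eqP; rewrite eq_le (W2_le_flip oT) (W2_le_flip oS).
Qed.

(* The geodesic point is reached from both ends by optimal maps, whose
   composition is an optimal map interpolated by the geodesic. *)
Lemma geodesic_point mu nu (s : R) : 0 < s < 1 ->
  (F mu < +oo)%E -> (F nu < +oo)%E ->
  exists (lam : P2 R d) (Ts T : V -> V),
  [/\ fine (F lam) <= (1 - s) * fine (F mu) + s * fine (F nu),
      (F lam < +oo)%E, W2 mu lam = s * W2 mu nu, optimal_map mu lam Ts &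
      optimal_map mu nu T /\ {ae mu, forall x, Ts x - x = s *: (T x - x)}].
Proof.
move=> s01 Fmu Fnu; have /andP[s0 s1] := s01.
have [lam [lam0 lam1 lamW] lamF] := Fconv mu nu.
have s01' : 0 <= s <= 1 by rewrite !ltW.
have := lamF s s01'; rewrite (functional_fineK Fmu) (functional_fineK Fnu).
rewrite -!EFinM -EFinD => Fl.
have Fly : (F (lam s) < +oo)%E by exact: le_lt_trans Fl (ltry _).
have W1 : W2 mu (lam s) = s * W2 mu nu.
  rewrite -(@eq_W2 _ _ (lam 0) mu (lam s) (lam s))// lamW ?lexx ?ler01//.
  by rewrite sub0r normrN gtr0_norm.
have W1' : W2 (lam s) nu = (1 - s) * W2 mu nu.
  rewrite -(@eq_W2 _ _ (lam s) (lam s) (lam 1) nu)// lamW ?lexx ?ler01//.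
  by rewrite distrC gtr0_norm// subr_gt0.
have [Ts oTs] := Fmap Fmu Fly; have [S oS] := Fmap Fly Fnu.
exists (lam s), Ts, (S \o Ts); split => //.
- by move: Fl; rewrite (functional_fineK Fly) lee_fin.
- exact: optimal_map_comp oTs oS W1 W1'.
Qed.

(** The geodesic supplied by convexity interpolates some optimal map [T']. By uniqueness [T] and
    [T'] agree almost everywhere, so [rho] is the geodesic point. *)
Lemma functional_interpolation mu nu (rho : P2 R d) (T : V -> V) (c : R) : 0 < c < 1 ->
  (F mu < +oo)%E -> (F nu < +oo)%E -> optimal_map mu nu T ->
  rho =m pushforward mu (fun x => (1 - c) *: x + c *: T x) ->
  (F rho < +oo)%E /\
  fine (F rho) <= (1 - c) * fine (F mu) + c * fine (F nu).
Proof.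
move=> c01 Fmu Fnu oT rhoE.
have [lam [Tc [T' [Flam Flamy _ oTc [oT' TcE]]]]] := geodesic_point c01 Fmu Fnu.
suff -> : F rho = F lam by [].
apply: eq_functional => A mA; rewrite rhoE// /pushforward.
have [mT _ _] := oT; have [mTc Tclam _] := oTc; rewrite -(Tclam _ mA).
have mI : measurable_fun setT (fun x : V => (1 - c) *: x + c *: T x).
  by apply: measurable_rVD; apply: measurable_rVZ.
have pre (f : V -> V) : measurable_fun setT f -> measurable (f @^-1` A).
  by move=> mf; rewrite -[X in measurable X]setTI; exact: mf.
have := filterI (optimal_map_unique (Fac Fmu) oT oT') TcE.
(* Off the null set [N] the two interpolations agree, so both preimages of [A] have the same
   mass. *)
move=> [N [mN muN HN]].
have agree x : ~ N x -> (1 - c) *: x + c *: T x = Tc x.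
  move=> nN; have [-> Tcx] : T x = T' x /\ Tc x - x = c *: (T' x - x).
    by apply: contrapT => nH; apply: nN; apply: HN.
  rewrite -[RHS](subrK x) Tcx scalerBl scale1r scalerBr.
  by rewrite addrC addrA [RHS]addrAC.
have negl B : measurable B -> mu B = mu (B `\` N).
  move=> mB; rewrite (measureDI mu mB mN) [X in (_ + X)%E](_ : _ = 0%E) ?adde0//.
  by apply: (@subset_measure0 _ _ _ _ _ N) => //; exact: measurableI.
rewrite /pushforward negl; last exact: pre.
rewrite [RHS]negl; last exact: pre.
congr (mu _); apply/seteqP; split => x [/= Ax nN]; split => //=.
  by rewrite -agree.
by rewrite agree.
Qed.

End Convexity.

(** * Change of the squared distance under one Euler step *)

Section Descent.
Variables (R : realType) (d : nat).
Local Notation V := 'rV[R]_d.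
Implicit Types mu nu rho : P2 R d.

Lemma integrable_sqnorm mu (f : V -> V) : in_L2 mu f ->
  mu.-integrable setT (fun x => (sqnorm (f x))%:E).
Proof.
move=> [mf fy]; apply/integrableP; split; first exact: measurable_EFin_sqnorm.
by under eq_integral => x _ do rewrite gee0_abs ?EFin_sqnorm_ge0//.
Qed.

Lemma integrable_dotp mu (f g : V -> V) : in_L2 mu f -> in_L2 mu g ->
  mu.-integrable setT (fun x => (dotp (f x) (g x))%:E).
Proof.
move=> fL gL; have [mf _] := fL; have [mg _] := gL.
apply: (@le_integrable _ _ _ _ _ measurableT _
  (fun x => (sqnorm (f x))%:E + (sqnorm (g x))%:E)%E).
- by apply/measurable_EFinP; exact: measurable_dotp.
- move=> x _; rewrite -EFinD /= lee_fin.
  have := norm_dotp_le (f x) (g x).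
  have := sqnorm_ge0 (f x); have := sqnorm_ge0 (g x) => a b c.
  rewrite [leRHS]ger0_norm ?addr_ge0//; lra.
- by apply: integrableD => //; exact: integrable_sqnorm.
Qed.

Lemma optimal_map_L2 mu nu (T : V -> V) : optimal_map mu nu T ->
  in_L2 mu (fun x => T x - x).
Proof.
move=> [mT _ Tc]; split; first exact: measurable_rVB.
by rewrite Tc ltry.
Qed.

Lemma integral_sqnorm_fineK mu (f : V -> V) : in_L2 mu f ->
  (\int[mu]_x (sqnorm (f x))%:E = (\int[mu]_x sqnorm (f x))%:E)%E.
Proof.
by move=> fL; rewrite /Rintegral fineK//; exact: integrable_fin_num (integrable_sqnorm fL).
Qed.

Lemma integral_dotp_fineK mu (f g : V -> V) : in_L2 mu f -> in_L2 mu g ->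
  (\int[mu]_x (dotp (f x) (g x))%:E = (\int[mu]_x dotp (f x) (g x))%:E)%E.
Proof.
by move=> fL gL; rewrite /Rintegral fineK//; exact: integrable_fin_num (integrable_dotp fL gL).
Qed.

(** Under [mu] the pair [(x - eta *: xi x, T x)] couples [mu'] with [nu]; its cost is the expanded
    square. *)
Lemma W2_sqr_step mu mu' nu (xi T : V -> V) (eta : R) :
  in_L2 mu xi -> optimal_map mu nu T ->
  mu' =m pushforward mu (fun x => x - eta *: xi x) ->
  W2 mu' nu ^+ 2 <= W2 mu nu ^+ 2 +
    2 * eta * (\int[mu]_x dotp (xi x) (T x - x)) +
    eta ^+ 2 * (\int[mu]_x sqnorm (xi x)).
Proof.
move=> xiL oT mu'E; have [mxi _] := xiL; have [mT Tnu Tc] := oT.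
have TL := optimal_map_L2 oT.
have mstep : measurable_fun setT (fun x : V => x - eta *: xi x).
  by apply: measurable_rVB => //; exact: measurable_rVZ.
have := @W2_sqr_le _ _ _ _ mu mu' nu _ _ mstep mT _ Tnu.
move=> /(_ (fun A mA => esym (mu'E A mA))).
under eq_integral => x _.
  rewrite (_ : sqnorm _ = sqnorm (T x - x) + (2 * eta) * dotp (xi x) (T x - x)
     + eta ^+ 2 * sqnorm (xi x)); last first.
    rewrite /sqnorm !dotpE (dotpC (T x) x) (dotpC (xi x) x) (dotpC (T x) (xi x)).
    ring.
  rewrite !EFinD !EFinM; over.
rewrite !integralD//=; last 4 first.
- exact: integrable_sqnorm.
- by apply: integrableZl => //; exact: integrable_dotp.
- apply: integrableD => //; first exact: integrable_sqnorm.
  by apply: integrableZl => //; exact: integrable_dotp.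
- by apply: integrableZl => //; exact: integrable_sqnorm.
rewrite !integralZl//; try exact: integrable_sqnorm; try exact: integrable_dotp.
by rewrite Tc integral_dotp_fineK// integral_sqnorm_fineK// -!EFinM -!EFinD lee_fin.
Qed.

End Descent.

(** * Summation of the descent inequalities with adaptive steps *)

Section WeightedSums.
Variables (R : realType).
Implicit Types f g r D : nat -> R.

(** Summation by parts: the weights [sqrt (G k)] do not decrease and [D k <= M], so the differences
    of [D] contribute the first term. The quadratic errors telescope into the second. *)
Lemma weighted_descent_sum f g r D (M rho : R) (n : nat) :
  let G k := \sum_(0 <= s < k.+1) g s in
  (forall k, 0 <= g k) -> (forall k, 0 < G k) -> (forall k, 0 <= r k) ->
  (forall k, D k.+1 <= D k - 2 * (r k / Num.sqrt (G k)) * f k +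
     (r k / Num.sqrt (G k)) ^+ 2 * g k) ->
  (forall k, (k <= n)%N -> D k <= M /\ r k <= rho) ->
  2 * \sum_(0 <= s < n.+1) r s * f s <=
    Num.sqrt (G n) * (M - D n.+1) + 2 * rho ^+ 2 * Num.sqrt (G n).
Proof.
move=> G g0 G0 r0 descent.
have q0 k : 0 < Num.sqrt (G k) by rewrite sqrtr_gt0.
have q2 k : Num.sqrt (G k) ^+ 2 = G k by rewrite sqr_sqrtr// ltW.
(* The descent inequality multiplied by [sqrt (G k)], the denominator of the step size. *)
have term k : 2 * (r k * f k) <=
    Num.sqrt (G k) * (D k - D k.+1) + r k ^+ 2 * (g k / Num.sqrt (G k)).
  have := descent k; set q := Num.sqrt (G k); have qk : 0 < q := q0 k.
  rewrite -(ler_pM2l qk) => h.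
  have e1 : q * (D k - 2 * (r k / q) * f k + (r k / q) ^+ 2 * g k) =
    q * D k - 2 * (r k * f k) + r k ^+ 2 * (g k / q).
    by field; rewrite gt_eqF.
  by rewrite e1 in h; lra.
(* [g k = G k - G k.-1] telescopes after division by [sqrt (G k)]. *)
have gq k : r k <= rho -> forall x, 0 <= x -> x ^+ 2 = G k - g k ->
    r k ^+ 2 * (g k / Num.sqrt (G k)) <= 2 * rho ^+ 2 * (Num.sqrt (G k) - x).
  move=> rk x x0 xE; set q := Num.sqrt (G k); have qk : 0 < q := q0 k.
  have qq : q ^+ 2 = G k := q2 k.
  have gE : g k = (q - x) * (q + x) by nra.
  have xq : x <= q.
    rewrite -(@ler_pXn2r _ 2) ?nnegrE ?(ltW qk)// qq xE.
    by have := g0 k; lra.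
  have h1 : g k / q <= 2 * (q - x).
    by rewrite ler_pdivrMr// gE; nra.
  have h2 : r k ^+ 2 <= rho ^+ 2.
    by rewrite ler_pXn2r ?nnegrE//; exact: le_trans (r0 k) rk.
  have gq0 : 0 <= g k / q by rewrite divr_ge0// ltW.
  apply: (le_trans (ler_wpM2r gq0 h2)).
  have := ler_wpM2l (sqr_ge0 rho) h1; lra.
elim: n => [|n IH] bnd.
  have [D0 r0rho] := bnd 0%N (leqnn _).
  (* Nothing precedes index 0, so 0 takes the place of the previous square root. *)
  have G0E : 0 ^+ 2 = G 0%N - g 0%N by rewrite /G big_nat1 subrr expr0n.
  rewrite big_nat1; have := term 0%N; have := gq 0%N r0rho 0 (lexx _) G0E.
  have := ler_wpM2l (ltW (q0 0%N)) D0; lra.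
have {}IH := IH (fun k kn => bnd k (leqW kn)).
have [Dn rn] := bnd n.+1 (leqnn _).
have GE : G n.+1 = G n + g n.+1 by rewrite /G big_nat_recr.
have qle : Num.sqrt (G n) <= Num.sqrt (G n.+1).
  by rewrite ler_sqrt GE ?lerDl//; have := G0 n; have := g0 n.+1; lra.
have qE : Num.sqrt (G n) ^+ 2 = G n.+1 - g n.+1 by rewrite q2 GE addrK.
rewrite big_nat_recr//= mulrDr.
have := gq n.+1 rn _ (ltW (q0 n)) qE; have := term n.+1.
have : 0 <= (Num.sqrt (G n.+1) - Num.sqrt (G n)) * (M - D n.+1).
  by rewrite mulr_ge0// subr_ge0.
lra.
Qed.

End WeightedSums.

(** * Global subgradient inequality and descent towards a competitor *)

Section Iterates.
Variables (R : realType) (d : nat) (F : P2 R d -> \bar R).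
Local Notation V := 'rV[R]_d.
Implicit Types mu nu rho : P2 R d.

Section Rbar.
Variables (r_eps : R) (mu : nat -> P2 R d).
Hypothesis r_eps0 : 0 < r_eps.

Lemma rbar_gt0 t : 0 < rbar r_eps mu t.
Proof. by rewrite /rbar lt_max r_eps0. Qed.

Lemma rbar_homo : {homo rbar r_eps mu : s t / (s <= t)%N >-> s <= t}.
Proof.
move=> s t st; rewrite /rbar ge_max !le_max lexx /=; apply/orP; right.
apply: sub_bigmax_seq => k; rewrite !mem_index_iota => /andP[_ ks].
exact: leq_trans ks _.
Qed.

Lemma W2_le_rbar s t : (s <= t)%N -> W2 (mu 0%N) (mu s) <= rbar r_eps mu t.
Proof.
move=> st; rewrite /rbar le_max; apply/orP; right.
apply: (Order.TotalTheory.le_bigmax_seq 0 s xpredT (fun k => W2 (mu 0%N) (mu k))) => //.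
by rewrite mem_index_iota ltnS.
Qed.

End Rbar.

Hypotheses (FNy : forall nu, (-oo < F nu)%E)
  (Flsc : W2_lower_semicontinuous F) (Fconv : geodesically_convex F)
  (Fac : forall nu, (F nu < +oo)%E -> absolutely_continuous nu)
  (Fmap : forall nu rho, (F nu < +oo)%E -> (F rho < +oo)%E ->
       exists tr : V -> V, optimal_map nu rho tr).

(* [T] depends on [e]: it is built from a geodesic point close to [mu]. *)
Lemma subdifferential_inequality mu nu (xi : V -> V) (e : R) :
  frechet_subdifferential F mu xi -> (F nu < +oo)%E -> 0 < e ->
  exists2 T : V -> V, optimal_map mu nu T &
    \int[mu]_x dotp (xi x) (T x - x) <= fine (F nu) - fine (F mu) + e * W2 mu nu.
Proof.
move=> [Fmu xiL sub] Fnu e0; have [delta delta0 subd] := sub e e0.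
have W0 := W2_ge0 mu nu; set W := W2 mu nu in W0 *.
have den0 : 0 < 2 * (W + delta) by lra.
(* This puts the geodesic point within [delta] of [mu], also when [W] is 0. *)
pose s := delta / (2 * (W + delta)).
have s0 : 0 < s by rewrite divr_gt0.
have s1 : s < 1 by rewrite ltr_pdivrMr// mul1r; lra.
have sW : s * W < delta by rewrite /s mulrAC ltr_pdivrMr//; nra.
have s01 : 0 < s < 1 by rewrite s0.
have [lam [Ts [T [Flam Flamy lamW oTs [oT TsE]]]]] :=
  geodesic_point FNy Fconv Fmap s01 Fmu Fnu.
exists T => //.
have TL := optimal_map_L2 oT; have TsL := optimal_map_L2 oTs.
have := subd lam Flamy _ Ts oTs; rewrite lamW => /(_ sW).
have [mxi _] := xiL; have [mTs _] := TsL; have [mT _] := TL.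
have -> : (\int[mu]_x (dotp (xi x) (Ts x - x))%:E =
    \int[mu]_x (s%:E * (dotp (xi x) (T x - x))%:E))%E.
  apply: ae_eq_integral => //.
  - by apply/measurable_EFinP; exact: measurable_dotp.
  - by apply: measurable_funeM; apply/measurable_EFinP; exact: measurable_dotp.
  - by apply: filterS TsE => x /= -> _; rewrite dotpZr EFinM.
rewrite integralZl//; last exact: integrable_dotp.
rewrite integral_dotp_fineK// (functional_fineK FNy Fmu) (functional_fineK FNy Flamy).
rewrite -EFinM -!EFinB lee_fin => h.
(* Both the local inequality at [lam] and the convexity bound on [F lam] are linear in [s], so the
   claim appears multiplied by [s]. *)
rewrite -(ler_pM2l s0).
move: h Flam; rewrite /= -/W; set l := fine (F lam); set J := (\int[mu]_x _).
lra.
Qed.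

(** The error in [subdifferential_inequality] is arbitrary and disappears here: the map that varies
    with it no longer occurs. *)
Lemma descent_step mu mu' nu (xi : V -> V) (eta : R) :
  frechet_subdifferential F mu xi -> (F nu < +oo)%E -> 0 <= eta ->
  mu' =m pushforward mu (fun x => x - eta *: xi x) ->
  W2 mu' nu ^+ 2 <= W2 mu nu ^+ 2 - 2 * eta * (fine (F mu) - fine (F nu)) +
    eta ^+ 2 * \int[mu]_x sqnorm (xi x).
Proof.
move=> sub Fnu eta0 mu'E; have W0 := W2_ge0 mu nu.
apply/ler_addgt0Pr => e e0.
have den0 : 0 < 2 * eta * W2 mu nu + 1.
  by have := mulr_ge0 eta0 W0; lra.
have [T oT] := subdifferential_inequality sub Fnu (divr_gt0 e0 den0).
set w := e / _ => h.
have we : 2 * eta * (w * W2 mu nu) <= e.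
  rewrite (_ : _ * (_ * _) = e * (2 * eta * W2 mu nu) / (2 * eta * W2 mu nu + 1)).
    by rewrite ler_pdivrMr// ler_pM2l//; lra.
  by rewrite /w; field; rewrite gt_eqF.
have [_ xiL _] := sub.
apply: (le_trans (W2_sqr_step xiL oT mu'E)).
have := ler_wpM2l (mulr_ge0 (ler0n R 2) eta0) h; lra.
Qed.

End Iterates.

(** * Jensen's inequality along the weighted averages *)

Section Averages.
Variables (R : realType) (d : nat) (F : P2 R d -> \bar R).
Local Notation V := 'rV[R]_d.

Hypotheses (FNy : forall nu, (-oo < F nu)%E)
  (Flsc : W2_lower_semicontinuous F) (Fconv : geodesically_convex F)
  (Fac : forall nu, (F nu < +oo)%E -> absolutely_continuous nu)
  (Fmap : forall nu rho : P2 R d, (F nu < +oo)%E -> (F rho < +oo)%E ->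
       exists tr : V -> V, optimal_map nu rho tr).

(** [avg n.+1] averages [mu 0] to [mu n]. Multiplied by the new partial sum, the weights [1 - c] and
    [c] become the old partial sum and the new [r], which drives the induction. *)
Lemma weighted_average_jensen (r : nat -> R) (mu avg : nat -> P2 R d)
    (T : nat -> V -> V) (n : nat) :
  (forall t, 0 < r t) -> (forall t, (F (mu t) < +oo)%E) ->
  avg 1%N =m mu 0%N ->
  (forall t, (1 <= t)%N -> optimal_map (avg t) (mu t) (T t) /\
     let c := r t / \sum_(0 <= s < t.+1) r s in
     avg t.+1 =m pushforward (avg t) (fun x => (1 - c) *: x + c *: T t x)) ->
  (F (avg n.+1) < +oo)%E /\
  (\sum_(0 <= s < n.+1) r s) * fine (F (avg n.+1)) <=
    \sum_(0 <= s < n.+1) r s * fine (F (mu s)).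
Proof.
move=> r0 Fmu avg1 avgS; elim: n => [|n [IHy IH]].
  by rewrite !big_nat1 (eq_functional FNy Flsc avg1).
have [oT /= avgE] := avgS n.+1 isT.
set S := \sum_(0 <= s < n.+1) r s in IH.
have S0 : 0 < S.
  rewrite /S big_nat_recl//; apply: ltr_pwDl => //.
  by apply: sumr_ge0 => k _; exact: ltW.
have SE : \sum_(0 <= s < n.+2) r s = S + r n.+1 by rewrite big_nat_recr.
rewrite SE in avgE *; set c := r n.+1 / _ in avgE.
have Sr0 : 0 < S + r n.+1 by rewrite addr_gt0.
have c01 : 0 < c < 1 by rewrite divr_gt0//= ltr_pdivrMr// mul1r; lra.
have [Fy Fle] :=
  functional_interpolation FNy Flsc Fconv Fac Fmap c01 IHy (Fmu n.+1) oT avgE.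
split=> //; rewrite big_nat_recr//=.
have := ler_wpM2l (ltW Sr0) Fle.
rewrite (_ : _ * (_ + _) = S * fine (F (avg n.+1)) + r n.+1 * fine (F (mu n.+1))).
  by move=> h; apply: (le_trans h); rewrite lerD2r.
by rewrite /c; field; rewrite gt_eqF.
Qed.

End Averages.

(** * Assembly of the bound for the averaged iterates *)

Theorem proposition46 (R : realType) :
  exists C : R, 0 < C /\
  forall (d : nat) (F : P2 R d -> \bar R) (pi : P2 R d)
    (mu : nat -> P2 R d) (xi : nat -> 'rV[R]_d -> 'rV[R]_d)
    (eta : nat -> R) (r_eps : R)
    (mu_avg : nat -> P2 R d) (tmap : nat -> 'rV[R]_d -> 'rV[R]_d) (T : nat),
    (forall nu : P2 R d, (-oo < F nu)%E) ->
    proper_functional F ->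
    W2_lower_semicontinuous F ->
    geodesically_convex F ->
    (forall nu : P2 R d, (F nu < +oo)%E -> absolutely_continuous nu) ->
    (forall nu rho : P2 R d, (F nu < +oo)%E -> (F rho < +oo)%E ->
       exists tr : 'rV[R]_d -> 'rV[R]_d, optimal_map nu rho tr) ->
    (forall nu : P2 R d, (F pi <= F nu)%E) ->
    0 < r_eps ->
    (forall t : nat, wasserstein_gradient F (mu t) (xi t)) ->
    (forall t : nat, 0 < gradient_sum mu xi t) ->
    (forall t : nat, eta t = rbar r_eps mu t / Num.sqrt (gradient_sum mu xi t)) ->
    (forall t : nat,
       mu t.+1 =m pushforward (mu t) (fun x => x - eta t *: xi t x)) ->
    mu_avg 1%N =m mu 0%N ->
    (forall t : nat, (1 <= t)%N ->
       optimal_map (mu_avg t) (mu t) (tmap t) /\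
       let c := rbar r_eps mu t / \sum_(0 <= s < t.+1) rbar r_eps mu s in
       mu_avg t.+1 =m pushforward (mu_avg t) (fun x => (1 - c) *: x + c *: tmap t x)) ->
    forall t : nat, (1 <= t <= T)%N ->
      (F (mu_avg t) - F pi <=
       (C * ((W2 (mu 0%N) pi + rbar r_eps mu t)
               * Num.sqrt (gradient_sum mu xi t.-1)
             / (\sum_(0 <= s < t) rbar r_eps mu s / rbar r_eps mu t)))%:E)%E.
Proof.
exists 3; split => [//|d F pi mu xi eta r_eps mu_avg tmap T].
move=> FNy [nu0 Fnu0] Flsc Fconv Fac Fmap Fpi r_eps0 grad G0 etaE muS avg1 avgS t.
case: t => [//|n] _; rewrite succnK.
have Fpiy : (F pi < +oo)%E by exact: le_lt_trans (Fpi nu0) Fnu0.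
have sub t : frechet_subdifferential F (mu t) (xi t) by case: (grad t).
have Fmu t : (F (mu t) < +oo)%E by case: (sub t).
set r := rbar r_eps mu in etaE avgS *; set G := gradient_sum mu xi in G0 etaE *.
have r0 t : 0 < r t by exact: rbar_gt0.
have [Favgy Favg] := weighted_average_jensen FNy Flsc Fconv Fac Fmap n r0 Fmu avg1 avgS.
pose D t := W2 (mu t) pi; pose f t := fine (F (mu t)) - fine (F pi).
pose d0 := D 0%N; have d00 : 0 <= d0 := W2_ge0 _ _.
have tri s t : W2 (mu s) pi <= W2 (mu s) (mu t) + W2 (mu t) pi.
  exact: (W2_triangle_functional Fmap).
(* Factor the difference of squares. Passing through [mu 0], the difference of the distances is at
   most [2 * r n.+1] and their sum at most [2 * (d0 + r n.+1)]. *)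
have DB k : (k <= n)%N -> D k ^+ 2 <= D n.+1 ^+ 2 + 4 * r n.+1 * (d0 + r n.+1).
  move=> kn; have rk := W2_le_rbar r_eps mu (leqW kn).
  have rn := W2_le_rbar r_eps mu (leqnn n.+1).
  have sym s : W2 (mu s) (mu 0%N) = W2 (mu 0%N) (mu s).
    exact: (W2_sym_functional Fmap).
  have h1 : D k <= r n.+1 + d0.
    by apply: (le_trans (tri k 0%N)); rewrite sym lerD2r.
  have h2 : D n.+1 <= r n.+1 + d0.
    by apply: (le_trans (tri n.+1 0%N)); rewrite sym lerD2r.
  have h3 : D k <= 2 * r n.+1 + D n.+1.
    apply: (le_trans (tri k n.+1)); rewrite lerD2r.
    apply: (@le_trans _ _ (W2 (mu k) (mu 0%N) + W2 (mu 0%N) (mu n.+1))).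
      exact: (W2_triangle_functional Fmap).
    by rewrite sym -/r in rk rn *; lra.
  have k0 : 0 <= D k := W2_ge0 _ _; have n0 : 0 <= D n.+1 := W2_ge0 _ _.
  have [Dlt|Dge] := leP (D k) (D n.+1).
    have := ler_pM k0 k0 Dlt Dlt; have := mulr_ge0 (ltW (r0 n.+1)) (addr_ge0 d00 (ltW (r0 n.+1))).
    by rewrite !expr2; lra.
  have : (D k - D n.+1) * (D k + D n.+1) <= (2 * r n.+1) * (2 * (d0 + r n.+1)).
    by apply: ler_pM; lra.
  by rewrite !expr2; lra.
(* With [M] taken from [DB], the terms [D n.+1 ^+ 2] cancel. Half of the rest is
   [(2 * r * d0 + 3 * r ^+ 2) * sqrt (G n)] with [r] at [n.+1], whence the constant 3. *)
have gap : 2 * \sum_(0 <= s < n.+1) r s * f s <=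
    Num.sqrt (G n) * (D n.+1 ^+ 2 + 4 * r n.+1 * (d0 + r n.+1) - D n.+1 ^+ 2) +
    2 * r n.+1 ^+ 2 * Num.sqrt (G n).
  apply: (@weighted_descent_sum R f (fun s => \int[mu s]_x sqnorm (xi s x)) r
    (fun k => D k ^+ 2)) => //.
  - move=> k; apply: fine_ge0; apply: integral_ge0 => x _; exact: EFin_sqnorm_ge0.
  - by move=> k; exact: ltW.
  - move=> k; rewrite -/(gradient_sum mu xi k) -/G -etaE.
    apply: (descent_step FNy Fconv Fmap) => //.
    by rewrite etaE divr_ge0 ?sqrtr_ge0// ltW.
  - move=> k kn; split; first exact: DB.
    by apply: rbar_homo => //; exact: leqW.
rewrite (functional_fineK FNy Favgy) (functional_fineK FNy Fpiy) -EFinB lee_fin.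
rewrite -mulr_suml; set S := \sum_(0 <= s < n.+1) r s in Favg *.
have S0 : 0 < S.
  rewrite /S big_nat_recl//; apply: ltr_pwDl => //.
  by apply: sumr_ge0 => k _; exact: ltW.
have fE : \sum_(0 <= s < n.+1) r s * f s =
    \sum_(0 <= s < n.+1) r s * fine (F (mu s)) - S * fine (F pi).
  by rewrite /S mulr_suml -sumrB; apply: eq_bigr => s _; rewrite mulrBr.
rewrite fE in gap.
rewrite invf_div !mulrA ler_pdivlMr//.
have q0 : 0 <= Num.sqrt (G n) := sqrtr_ge0 _.
have rq : 0 <= r n.+1 * d0 * Num.sqrt (G n) by rewrite !mulr_ge0// ltW.
have rq' : 0 <= r n.+1 ^+ 2 * Num.sqrt (G n) by rewrite mulr_ge0// sqr_ge0.
rewrite -[W2 (mu 0%N) pi]/d0; lra.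
Qed.
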